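(* Let $K$ be a field complete with respect to a discrete valuation $v$, with residue field of characteristic $p$ (possibly $0$), valuation ring $\mathcal{O}$ and maximal ideal $\mathfrak{m}$. Let $\ell\ge2$ be an integer not divisible by $p$, let $c\in K^\times$, $f(z)=z^\ell-c$, and $a\in K$. Suppose that $v(c)\ge0$ and $v(a)\ge0$. (a) If $a\bmod\mathfrak{m}$ is not in the forward orbit of $0\bmod\mathfrak{m}$, then $K_\infty/K$ is unramified. (b) If $0\bmod\mathfrak{m}$ is strictly preperiodic mod $\mathfrak{m}$, then the ramification index of $K_\infty/K$ divides $\ell$. (c) If $0$ and $a$ are in a single cycle, then $K_\infty/K$ is unramified. (d) If $0\bmod\mathfrak{m}$ and $a\bmod\mathfrak{m}$ are in a single cycle mod $\mathfrak{m}$, but $0$ and $a$ are not both in a single cycle, then $K_\infty/K$ is infinitely ramified.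
   Context: $f^n$ denotes the $n$-th iterate of $f$; $f^{-n}(a)$ is the multiset of solutions of $f^n(z)=a$ in an algebraic closure $\overline{K}$; $K_n=K(f^{-n}(a))$ and $K_\infty=\bigcup_{n\ge1}K_n$. The valuation $v$ is extended to $\overline{K}$; the ramification index of $K_\infty/K$ is $(v(K_\infty^\times):v(K^\times))$, and ''infinitely ramified'' means that it is infinite. An element $u\in K$ is periodic (for $f$) if $f^n(u)=u$ for some $n\ge1$; preperiodic if $f^m(u)$ is periodic for some $m\ge0$; strictly preperiodic if it is preperiodic but not periodic. Elements $u,w\in K$ are in a single cycle if $u$ is periodic and there exists $n\ge0$ such that $f^n(u)=w$. The forward orbit of $u$ is $\{f^n(u):n\ge0\}$. The same notions are used for the dynamics of the reduction $z\mapsto z^\ell-(c\bmod\mathfrak{m})$ of $f$ on the residue field $\mathcal{O}/\mathfrak{m}$; ''mod $\mathfrak{m}$'' refers to that dynamics. *)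

(* Defs.v *)
From HB Require Import structures.
From mathcomp Require Import all_boot all_order all_algebra.
From mathcomp Require Import ring_quotient separable.
From mathcomp Require Import boolp classical_sets functions cardinality.
From mathcomp Require Import constructive_ereal.

Set Implicit Arguments.
Unset Strict Implicit.
Unset Printing Implicit Defensive.

Import Order.TTheory GRing.Theory Num.Theory.

Local Open Scope classical_set_scope.
Local Open Scope ring_scope.

(* Every discrete valuation, and every extension of it to an algebraic
   extension, can be scaled to have its value group inside rat, so rational
   values suffice for both K and its algebraic closure. *)
Record valuation (K : fieldType) := Valuation {
  vfun :> K -> \bar rat;
  val_neqNy : forall x, vfun x != -oo%E;
  val_eqy : forall x, (vfun x == +oo%E) = (x == 0);
  valM : forall x y, vfun (x * y) = (vfun x + vfun y)%E;
  val_ultra : forall x y, (Order.min (vfun x) (vfun y) <= vfun (x + y))%E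
}.

Section ValuationRing.
Variables (K : fieldType) (v : valuation K).

Lemma val0 : v 0 = +oo%E.
Proof. by apply/eqP; rewrite val_eqy. Qed.

Lemma val_fin x : x != 0 -> exists r, v x = r%:E.
Proof.
move: (val_neqNy v x) (val_eqy v x); case: (v x) => [r||] //.
- by move=> _ _ _; exists r.
- by move=> _; rewrite eqxx => <-.
Qed.

Lemma val1 : v 1 = 0%E.
Proof.
have [r vr] := val_fin (oner_neq0 K).
have := valM v 1 1; rewrite mulr1 vr -EFinD => -[] /eqP.
by rewrite -subr_eq subrr eq_sym => /eqP ->.
Qed.

Lemma valN x : v (- x) = v x.
Proof.
have vN1 : v (-1) = 0%E.
  have [|r vr] := @val_fin (-1); first by rewrite oppr_eq0 oner_neq0.
  have := valM v (-1) (-1); rewrite mulrNN mulr1 val1 vr -EFinD => -[] /eqP.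
  by rewrite eq_sym -mulr2n mulrn_eq0 /= => /eqP ->.
by rewrite -mulN1r valM vN1 add0e.
Qed.

Lemma valV x : x != 0 -> (v x + v (x^-1)%R = 0)%E.
Proof. by move=> x0; rewrite -valM divff // val1. Qed.

Definition in_val_ring : {pred K} := fun x => (0 <= v x)%E.

Lemma in_val_ring_subring : subring_closed in_val_ring.
Proof.
split=> [|x y|x y]; rewrite /in_val_ring !unfold_in /=.
- by rewrite val1.
- move=> hx hy; apply: le_trans (val_ultra v x (- y)).
  by rewrite valN le_min hx hy.
- by move=> hx hy; rewrite valM adde_ge0.
Qed.

HB.instance Definition _ :=
  GRing.isSubringClosed.Build K in_val_ring in_val_ring_subring.

Record val_ring := ValRing { val_ring_val : K; _ : val_ring_val \in in_val_ring }.

HB.instance Definition _ := [isSub for val_ring_val].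
HB.instance Definition _ := [Choice of val_ring by <:].
HB.instance Definition _ := [SubChoice_isSubComNzRing of val_ring by <:].

Definition max_ideal : {pred val_ring} := fun x => (0 < v (val x))%E.

Lemma max_ideal_idealr : idealr_closed max_ideal.
Proof.
split=> [||a x y].
- by rewrite unfold_in rmorph0 val0.
- by rewrite unfold_in rmorph1 val1 ltxx.
- rewrite !unfold_in => hx hy; rewrite rmorphD rmorphM.
  apply: lt_le_trans (val_ultra v _ _); rewrite lt_min hy andbT valM.
  by apply: lt_le_trans hx (leeDr _ _); exact: (valP a).
Qed.

HB.instance Definition _ := isIdealr.Build val_ring max_ideal max_ideal_idealr.

Definition residue := {ideal_quot max_ideal}.

HB.instance Definition _ := GRing.ComNzRing.on residue.

(* The class of x modulo the maximal ideal, and 0 if x is not in the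
   valuation ring. *)
Definition reduction (x : K) : residue :=
  \pi_residue%qT (insubd (0 : val_ring) x).

Definition residue_inv (t : residue) : residue :=
  if t == 0 then 0 else reduction (val (repr t : val_ring))^-1.

Lemma residue_mulVf (t : residue) : t != 0 -> residue_inv t * t = 1.
Proof.
move=> t0; rewrite /residue_inv (negPf t0); move: t0.
rewrite -[t in t != 0]reprK -(rmorph0 \pi_residue%qT) -Quotient.idealrBE subr0.
set x := repr t; move=> hx.
have vx : v (val x) = 0%E.
  apply/eqP; rewrite eq_le; apply/andP; split; last exact: (valP x).
  by rewrite leNgt.
have x0 : val x != 0 by rewrite -(val_eqy v) vx.
have hV : (val x)^-1 \in in_val_ring.
  by rewrite unfold_in; have := valV x0; rewrite vx add0e => ->.
rewrite -[t in _ * t]reprK -/x /reduction -rmorphM.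
rewrite -(rmorph1 \pi_residue%qT); congr (\pi_residue%qT _).
by apply: val_inj; rewrite rmorphM rmorph1 /= insubdK // mulVf.
Qed.

Lemma residue_inv0 : residue_inv 0 = 0.
Proof. by rewrite /residue_inv eqxx. Qed.

HB.instance Definition _ :=
  GRing.ComNzRing_isField.Build residue residue_mulVf residue_inv0.

Definition value_group (E : set K) : set rat :=
  [set fine (v x) | x in [set x | E x /\ x != 0]].

(* The value group is infinite cyclic; it need not be normalized to be the
   group of integers. *)
Definition discrete_valuation : Prop :=
  exists2 g : rat, 0 < g & value_group setT = range (fun m : int => g *~ m).

Definition complete_valuation : Prop :=
  forall x : nat -> K,
    (forall M : rat, exists N, forall i j, (N <= i)%N -> (N <= j)%N ->
       (M%:E <= v (x i - x j)%R)%E) ->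
    exists y, forall M : rat, exists N, forall i, (N <= i)%N ->
       (M%:E <= v (x i - y)%R)%E.

End ValuationRing.

Arguments reduction {K} v x.
Arguments value_group {K} v E.

Section Dynamics.
Variables (T : Type) (f : T -> T).

Definition periodic (u : T) : Prop := exists2 n, (1 <= n)%N & iter n f u = u.

Definition preperiodic (u : T) : Prop := exists m, periodic (iter m f u).

Definition strictly_preperiodic (u : T) : Prop := preperiodic u /\ ~ periodic u.

Definition in_single_cycle (u w : T) : Prop :=
  periodic u /\ exists n, iter n f u = w.

Definition forward_orbit (u : T) : set T := range (fun n => iter n f u).

End Dynamics.

Definition unicritical (R : nzRingType) (l : nat) (c z : R) : R := z ^+ l - c.

Section Extension.
Variables (K : fieldType) (L : closedFieldType) (iota : {rmorphism K -> L}).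

Definition is_algebraic_closure : Prop := forall x : L, algebraicOver iota x.

Definition subfield_adjoin (G : set L) : set L :=
  smallest [set E : set L | divring_closed (mem E)] (range iota `|` G).

Variables (l : nat) (c a : K).

Definition backward_orbit (n : nat) : set L :=
  [set z | iter n (unicritical l (iota c)) z = iota a].

Definition K_ (n : nat) : set L := subfield_adjoin (backward_orbit n).

Definition K_infty : set L := \bigcup_(n in [set n | (1 <= n)%N]) K_ n.

End Extension.

Section Ramification.
Variables (K : fieldType) (v : valuation K).
Variables (L : fieldType) (w : valuation L) (iota : K -> L).

Definition extends_valuation : Prop := forall x, w (iota x) = v x.

(* The quotient of the value group of E by that of K, as a set of cosets. *)
Definition value_cosets (E : set L) : set (set rat) :=
  [set [set g + h | h in value_group v setT] | g in value_group w E].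

Definition ramification_index (E : set L) (e : nat) : Prop :=
  (value_cosets E #= `I_e)%card.

Definition infinitely_ramified (E : set L) : Prop :=
  infinite_set (value_cosets E).

(* When w extends v along iota this is the induced embedding of residue
   fields, and does not depend on the representative chosen. *)
Definition residue_embedding (t : residue v) : residue w :=
  reduction w (iota (val (repr t : val_ring v))).

Definition residually_separable (E : set L) : Prop :=
  forall x, E x -> (0 <= w x)%E ->
  exists P : {poly residue v},
    [/\ irreducible_poly P, separable_poly P &
        root (map_poly residue_embedding P) (reduction w x)].

(* The residue field of K need not be perfect, so separability of the residue
   field extension is part of the definition. *)
Definition unramified (E : set L) : Prop :=
  ramification_index E 1 /\ residually_separable E.

End Ramification.

Definition has_characteristic (R : nzRingType) (p : nat) : Prop :=
  p \in [pchar R] \/ (p = 0%N /\ [pchar R] =i pred0).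

(* Main.v *)
From mathcomp Require Import all_boot all_order all_algebra all_field.
From mathcomp Require Import ring_quotient boolp ring.
Require Import Defs.
From HB Require Import structures.
From mathcomp Require Import classical_sets cardinality constructive_ereal.

(** Write f for z |-> z^l - c. A backward orbit of a is a chain y_0 = a,
y_(i+1)^l = y_i + c, so K_infty is obtained by adjoining l-th roots. As l is
invertible in the residue field, adjoining an l-th root of a unit creates no
ramification; everything depends on the steps where y_i is close to 0, that
is, reduces to 0.

Unramified side. [max_unramified] is the union of the fields K[theta], where
theta lifts an element of the residue field of Kbar separable over that of K
and is a root of a monic lift of its minimal polynomial. The powers of such a
theta are orthonormal for w ([generator_orthogonal]), so K[theta] has the
value group of K and a residue field generated by the reduction of theta, and
completeness of K makes it closed in Kbar. By Newton's method
([simple_root_mem]) it contains every root of an integral polynomial that is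
simple modulo the maximal ideal and has its reduction in the residue field.
With the primitive element theorem in the residue fields
([separable_over_pair]) this shows that the union is a field, closed under
l-th roots of units ([max_unramified_rootn]).

If a is not in the forward orbit of 0 modulo the maximal ideal, no y_i with
i > 0 reduces to 0, because f^i(y_i) = a would give f^i(0) = a there; hence
K_infty is unramified.

If 0 is strictly preperiodic modulo the maximal ideal, at most one y_i with
i > 0 of a given chain reduces to 0: two of them would make 0 periodic. Its
l-th power lies in the maximal unramified extension, so if it is not 0, it is
a power of a uniformizer pi of K times a unit, and K_infty is contained in the
maximal unramified extension of K(pi^(1/l)). That field is complete, with value group
generated by v(pi)/l, and so the previous theory applies to it; the index of
the value group of K in that of K_infty then divides l
([ramification_index_dvd]).

In the periodic cases let n be the exact period of 0 modulo the maximal ideal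
and e = f^n(0). On the elements z close to 0 the return map f^n satisfies
v(f^n(z) - e) = l v(z) ([return_map_val]): only the first of the n steps
passes close to the critical point, and the others are isometries. If e is
not 0, every later return of 0 has the same valuation as e, so 0 is not
periodic; if e = 0, a nonzero z close to 0 never lands on the orbit of 0. So
when 0 and a are in one cycle, every y_i with i > 0 is a unit or 0, and
K_infty is unramified. When they are in one cycle only modulo the maximal
ideal, the estimate is read backwards: if v(y) < v(e), an f^n-preimage of y
close to 0 has valuation v(y)/l ([preimage_descent]). Once an iterated
preimage y of a with 0 < v(y) < v(e) and v(y) finite is found
([preimage_below]), the values v(y)/l^k lie in infinitely many cosets of the
value group of K. *)

Set Implicit Arguments.
Unset Strict Implicit.
Unset Printing Implicit Defensive.

Import Order.TTheory GRing.Theory Num.Theory.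

Local Open Scope classical_set_scope.
Local Open Scope ring_scope.

(** * Separable elements over an embedded field *)

Lemma irreducible_annihilator (F L : fieldType) (emb : {rmorphism F -> L})
    (p : {poly F}) x :
  p != 0 -> root (map_poly emb p) x ->
  exists2 q, irreducible_poly q & root (map_poly emb q) x.
Proof.
move=> p0 px.
have exn : exists n,
    `[< exists q, [/\ q != 0, root (map_poly emb q) x & size q = n] >].
  by exists (size p); apply/asboolP; exists p.
case: (ex_minnP exn) => n /asboolP[q [q0 qx sq]] minq; exists q => //.
apply/(subfx_irreducibleP qx q0) => r rx r0; rewrite sq; apply: minq.
by apply/asboolP; exists r.
Qed.

Section SeparableElements.
Variables (F L : fieldType) (emb : {rmorphism F -> L}).

Definition separable_over (x : L) : Prop := exists P : {poly F},
  [/\ irreducible_poly P, separable_poly P & root (map_poly emb P) x].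

Definition adjoined (z x : L) : Prop := exists q, x = (map_poly emb q).[z].

(** A finite extension of F mapped into L: the transport device that makes the
theory of finite extensions, which lives inside one ambient finite extension,
available for elements of an arbitrary L. *)
Record embedded_ext := EmbeddedExt {
  ext_field : fieldExtType F;
  ext_emb : {rmorphism ext_field -> L};
  ext_embE : forall a, ext_emb a%:A = emb a }.

Lemma ext_map_poly (M : embedded_ext) (q : {poly F}) :
  map_poly (ext_emb M) (map_poly (in_alg (ext_field M)) q) = map_poly emb q.
Proof.
by rewrite -map_poly_comp; apply: eq_map_poly => a /=; rewrite ext_embE.
Qed.

(** The new generator is adjoined to M, and the scalars are then restricted
back to F. *)
Lemma embed_one_more (M : embedded_ext) (p : {poly F}) y :
  p != 0 -> root (map_poly emb p) y ->
  exists M' : embedded_ext,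
    (forall m, exists m', ext_emb M' m' = ext_emb M m) /\
    exists y', ext_emb M' y' = y.
Proof.
move=> p0 py.
have [||q irrq qy] := @irreducible_annihilator _ _ (ext_emb M)
   (map_poly (in_alg (ext_field M)) p) y.
- by rewrite map_poly_eq0.
- by rewrite ext_map_poly.
have q0 := irredp_neq0 irrq.
pose M1 : fieldExtType (ext_field M) := SubFieldExtType qy irrq.
pose j' : {rmorphism baseFieldType M1 -> L} :=
  (subfx_inj : {rmorphism subFExtend (ext_emb M) y q -> L}).
have j'E a : j' a%:A = emb a.
  rewrite -(ext_embE M).
  by rewrite -[RHS](subfx_inj_base qy q0).
exists (EmbeddedExt j'E); split=> [m|] /=.
  by exists (m%:A : M1); rewrite -[RHS](subfx_inj_base qy q0).
by exists (subfx_root (ext_emb M) y q); exact: (subfx_inj_root qy q0).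
Qed.

Lemma base_ext : inhabited embedded_ext.
Proof.
have irr : irreducible_poly ('X : {poly F}).
  by rewrite -[X in irreducible_poly X]subr0; exact: irredp_XsubC.
have x0 : root (map_poly emb 'X) 0 by rewrite map_polyX rootX.
pose M := SubFieldExtType x0 irr.
pose j : {rmorphism M -> L} := (subfx_inj : {rmorphism subFExtend emb 0 'X -> L}).
have jE : forall a, j a%:A = emb a := subfx_inj_base x0 (irredp_neq0 irr).
by constructor; exact: EmbeddedExt jE.
Qed.

Lemma ext_root (M : embedded_ext) (p : {poly F}) (x : ext_field M) :
  root (map_poly (in_alg (ext_field M)) p) x = root (map_poly emb p) (ext_emb M x).
Proof. by rewrite -(ext_map_poly M) fmorph_root. Qed.

(** Separability does not depend on the finite extension in which it is tested,
as both notions speak of the minimal polynomial over F. *)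
Lemma ext_separable (M : embedded_ext) (x : ext_field M) :
  separable_element 1 x <-> separable_over (ext_emb M x).
Proof.
split=> [sx|[P [iP sP Px]]]; last first.
  apply/separable_elementP; exists (map_poly (in_alg _) P); split.
  - by apply/polyOver1P; exists P.
  - by rewrite ext_root.
  - by rewrite separable_map.
have /polyOver1P[P PE] := minPolyOver 1 x.
have P0 : P != 0.
  by rewrite -(map_poly_eq0 (in_alg (ext_field M))) -PE monic_neq0 ?monic_minPoly.
have Px : root (map_poly emb P) (ext_emb M x) by rewrite -ext_root -PE root_minPoly.
have [q irrq qx] := irreducible_annihilator P0 Px.
exists q; split => //.
have : minPoly 1 x %| map_poly (in_alg (ext_field M)) q.
  by rewrite minPoly_dvdp ?ext_root //; apply/polyOver1P; exists q.
rewrite PE dvdp_map => /(apply_irredp irrq) Pq.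
rewrite -(eqp_separable (Pq _)).
  by rewrite -(separable_map (in_alg (ext_field M))) -PE.
by rewrite -(size_map_poly (in_alg (ext_field M))) -PE size_minPoly.
Qed.

Lemma ext_adjoined (M : embedded_ext) (z x : ext_field M) :
  x \in <<1; z>>%VS <-> adjoined (ext_emb M z) (ext_emb M x).
Proof.
split=> [/Fadjoin_polyP[p /polyOver1P[q ->] ->]|[q qx]].
  by exists q; rewrite -(ext_map_poly M) horner_map.
apply/Fadjoin_polyP; exists (map_poly (in_alg (ext_field M)) q).
  by apply/polyOver1P; exists q.
by apply: (fmorph_inj (ext_emb M)); rewrite -horner_map ext_map_poly.
Qed.

(** An irreducible polynomial sharing a root with a separable polynomial divides
it, hence has only simple roots. *)
Lemma separable_over_deriv (q : {poly F}) x :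
  separable_over x -> irreducible_poly q -> root (map_poly emb q) x ->
  (map_poly emb q)^`().[x] != 0.
Proof.
move=> [P [iP sP Px]] iq qx.
have : separable_poly q.
  apply: dvdp_separable sP.
  have : ~~ coprimep q P.
    apply/negP => cop.
    have : coprimep (map_poly emb q) (map_poly emb P) by rewrite coprimep_map.
    by move=> /coprimep_root/(_ qx)/negP; apply.
  by rewrite irreducible_poly_coprime // negbK.
by rewrite -(separable_map emb) unlock => /coprimep_root/(_ qx).
Qed.

Lemma ext_of_pair (x y : L) (p q : {poly F}) :
  p != 0 -> root (map_poly emb p) x -> q != 0 -> root (map_poly emb q) y ->
  exists M : embedded_ext, exists x' y' : ext_field M,
    ext_emb M x' = x /\ ext_emb M y' = y.
Proof.
move=> p0 px q0 qy; have [M0] := base_ext.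
have [M1 [_ [x1 x1E]]] := embed_one_more M0 p0 px.
have [M2 [i [y2 y2E]]] := embed_one_more M1 q0 qy.
by have [x2 x2E] := i x1; exists M2, x2, y2; rewrite x2E.
Qed.

Lemma separable_over_adjoined z x :
  separable_over z -> adjoined z x -> separable_over x.
Proof.
move=> sz; have [P [/irredp_neq0 P0 _ Pz]] := sz.
have [M [z' [_ [zE _]]]] := ext_of_pair P0 Pz P0 Pz.
move=> [q ->]; rewrite -zE -(ext_map_poly M) horner_map; apply/ext_separable.
move: sz; rewrite -zE => /ext_separable.
rewrite adjoin_separable_eq => /separableP; apply.
apply/Fadjoin_polyP; exists (map_poly (in_alg (ext_field M)) q) => //.
by apply/polyOver1P; exists q.
Qed.

(** The primitive element theorem, carried out in a finite extension embedded
in L that contains x and y. *)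
Lemma separable_over_pair x y :
  separable_over x -> separable_over y ->
  exists z, [/\ separable_over z, adjoined z x & adjoined z y].
Proof.
move=> sx sy; have [P [/irredp_neq0 P0 _ Px]] := sx.
have [Q [/irredp_neq0 Q0 _ Qy]] := sy.
have [M [x' [y' [xE yE]]]] := ext_of_pair P0 Px Q0 Qy.
rewrite -xE in sx *; rewrite -yE in sy *.
move/ext_separable in sx; move/ext_separable in sy.
have [z zE] := Primitive_Element_Theorem y' sx.
have sep1z : separable 1 <<1; z>>%AS.
  apply: (@separable_trans _ _ <<1; x'>>%AS); first by rewrite -adjoin_separable_eq.
  have -> : <<1; z>>%AS = <<<<1; x'>>; y'>>%AS by apply: val_inj.
  by rewrite -adjoin_separable_eq; apply: separable_elementS sy; exact: sub1v.
exists (ext_emb M z); split.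
- by apply/ext_separable; rewrite adjoin_separable_eq.
- by apply/ext_adjoined; rewrite -zE; apply: subvP_adjoin; exact: memv_adjoin.
- by apply/ext_adjoined; rewrite -zE memv_adjoin.
Qed.

(** The polynomial X^l - s is separable over F(s), and separability is
transitive. *)
Lemma separable_over_rootn l s y : (l%:R != 0 :> F) -> s != 0 ->
  separable_over s -> y ^+ l = s -> separable_over y.
Proof.
move=> l0 s0 ss ys; have [P [/irredp_neq0 P0 _ Ps]] := ss.
have l_gt0 : (0 < l)%N by case: l l0 {ys} => //; rewrite eqxx.
have Q0 : P \Po 'X^l != 0.
  by rewrite comp_poly_eq0 // size_polyXn.
have Qy : root (map_poly emb (P \Po 'X^l)) y.
  by rewrite map_comp_poly map_polyXn rootE horner_comp hornerXn ys.
have [M [s' [y' [sE yE]]]] := ext_of_pair P0 Ps Q0 Qy.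
rewrite -sE in ss; move/ext_separable in ss.
have yls : y' ^+ l = s'.
  by apply: (fmorph_inj (ext_emb M)); rewrite rmorphXn /= yE sE.
rewrite -yE; apply/ext_separable; apply: (adjoin_separable ss).
apply/separable_elementP; exists ('X^l - s'%:P); split.
- by rewrite rpredB ?rpredX ?polyOverX ?polyOverC ?memv_adjoin.
- by rewrite rootE !hornerE yls subrr.
rewrite unlock derivB derivXn derivC subr0 -scaler_nat coprimepZr.
  rewrite coprimep_expr // -['X]subr0 -(rmorph0 polyC) coprimep_XsubC rootE !hornerE.
  rewrite oppr0 expr0n eqn0Ngt l_gt0 sub0r oppr_eq0.
  by rewrite -(fmorph_eq0 (ext_emb M)) sE.
by rewrite -(rmorph_nat (in_alg (ext_field M))) fmorph_eq0.
Qed.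
End SeparableElements.

(** * Valuations and their residue fields *)

Section Valuation.
Variables (L : fieldType) (w : valuation L).
Implicit Types (x y z : L).

Lemma val0_neq0 x : w x = 0%E -> x != 0.
Proof. by move=> wx; rewrite -(val_eqy w) wx. Qed.

Lemma val_expr x r n : w x = r%:E -> w (x ^+ n) = (r *+ n)%:E.
Proof.
move=> wx; elim: n => [|n IH]; first by rewrite expr0 mulr0n val1.
by rewrite exprS mulrS valM wx IH -EFinD.
Qed.

Lemma val_expr0 x n : w x = 0%E -> w (x ^+ n) = 0%E.
Proof. by move=> wx; rewrite (val_expr n wx) mul0rn. Qed.

Lemma val_inv x r : w x = r%:E -> w x^-1 = (- r)%:E.
Proof.
move=> wx; have x0 : x != 0 by rewrite -(val_eqy w) wx.
have := valV w x0; rewrite wx.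
case: (w x^-1) (val_neqNy w x^-1) => //= s _ /eqP.
by rewrite -EFinD eqe addrC addr_eq0 => /eqP ->.
Qed.

Lemma val_div x y r s : w x = r%:E -> w y = s%:E -> w (x / y) = (r - s)%:E.
Proof. by move=> wx wy; rewrite valM wx (val_inv wy) -EFinD. Qed.

Lemma val_root x l : (0 < l)%N -> w (x ^+ l) = 0%E -> w x = 0%E.
Proof.
move=> l0 wl; have x0 : x != 0.
  by apply: contraTneq (val0_neq0 wl) => ->; rewrite expr0n eqn0Ngt l0 eqxx.
have [r wr] := val_fin w x0; move: wl; rewrite (val_expr l wr) => -[] /eqP.
by rewrite mulrn_eq0 eqn0Ngt l0 /= wr => /eqP ->.
Qed.

Lemma val_root_ge0 x l : (0 < l)%N -> (0 <= w (x ^+ l)%R)%E -> (0 <= w x)%E.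
Proof.
move=> l0; have [->|x0] := eqVneq x 0; first by rewrite val0 leey.
have [r wr] := val_fin w x0; rewrite (val_expr l wr) wr !lee_fin.
by rewrite pmulrn_lge0.
Qed.

Lemma val_expr_gt0 x l : (0 < l)%N -> (0 < w x)%E -> (0 < w (x ^+ l)%R)%E.
Proof.
move=> l0; have [->|x0] := eqVneq x 0; first by rewrite expr0n eqn0Ngt l0 val0.
have [r wr] := val_fin w x0; rewrite (val_expr l wr) wr !lte_fin.
by rewrite pmulrn_lgt0.
Qed.

Lemma valB x y : w (x - y) = w (y - x).
Proof. by rewrite -opprB valN. Qed.

Lemma val_add_ge r x y : (r <= w x)%E -> (r <= w y)%E -> (r <= w (x + y)%R)%E.
Proof. by move=> rx ry; apply: le_trans (val_ultra w x y); rewrite le_min rx. Qed.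

Lemma val_sub_ge r x y : (r <= w x)%E -> (r <= w y)%E -> (r <= w (x - y)%R)%E.
Proof. by move=> rx ry; apply: val_add_ge; rewrite ?valN. Qed.

Lemma val_add_gt r x y : (r < w x)%E -> (r < w y)%E -> (r < w (x + y)%R)%E.
Proof. by move=> rx ry; apply: lt_le_trans (val_ultra w x y); rewrite lt_min rx. Qed.

Lemma val_sub_gt r x y : (r < w x)%E -> (r < w y)%E -> (r < w (x - y)%R)%E.
Proof. by move=> rx ry; apply: val_add_gt; rewrite ?valN. Qed.

Lemma val_mul_ge0 x y : (0 <= w x)%E -> (0 <= w y)%E -> (0 <= w (x * y)%R)%E.
Proof. by move=> *; rewrite valM adde_ge0. Qed.

Lemma val_mul_ge r x y : (r <= w x)%E -> (0 <= w y)%E -> (r <= w (x * y)%R)%E.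
Proof. by move=> rx y0; rewrite valM; apply: (le_trans rx); rewrite leeDl. Qed.

Lemma val_mul_gt r x y : (r < w x)%E -> (0 <= w y)%E -> (r < w (x * y)%R)%E.
Proof. by move=> rx y0; rewrite valM; apply: (lt_le_trans rx); rewrite leeDl. Qed.

Lemma val_add_lt x y : (w x < w y)%E -> w (x + y)%R = w x.
Proof.
move=> xy; apply/eqP; rewrite eq_le (val_add_ge (lexx _) (ltW xy)) andbT leNgt.
apply/negP => h; have := val_sub_gt h xy; by rewrite addrK ltxx.
Qed.

Lemma val_sum_ge (I : Type) (s : seq I) (P : pred I) (F : I -> L) r :
  (forall i, P i -> (r <= w (F i))%E) -> (r <= w (\sum_(i <- s | P i) F i)%R)%E.
Proof.
move=> h; elim/big_ind: _ => //; first by rewrite val0 leey.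
by move=> x y; exact: val_add_ge.
Qed.

Lemma val_sum_gt (I : Type) (s : seq I) (P : pred I) (F : I -> L) r :
  (r < +oo)%E ->
  (forall i, P i -> (r < w (F i))%E) -> (r < w (\sum_(i <- s | P i) F i)%R)%E.
Proof.
move=> ry h; elim/big_ind: _ => //; first by rewrite val0.
by move=> x y; exact: val_add_gt.
Qed.

Lemma val_min (I : finType) (i0 : I) (F : I -> L) :
  exists i, forall j, (w (F i) <= w (F j))%E.
Proof.
have [i _ h] := @Order.TotalTheory.arg_minP _ _ I i0 predT (fun i => w (F i)) isT.
by exists i => j; apply: h.
Qed.

Lemma val_sum_min (I : finType) (i0 : I) (F : I -> L) :
  exists i, (w (F i) <= w (\sum_i F i)%R)%E.
Proof. by have [i h] := val_min i0 F; exists i; apply: val_sum_ge. Qed.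

Lemma val_nat n : (0 <= w n%:R)%E.
Proof. by elim: n => [|n IH]; rewrite ?val0 ?leey // mulrS val_add_ge ?val1. Qed.

Lemma val_expr_ge0 x n : (0 <= w x)%E -> (0 <= w (x ^+ n)%R)%E.
Proof.
by move=> x0; elim: n => [|n IH]; rewrite ?expr0 ?val1 // exprS val_mul_ge0.
Qed.

Lemma val_sum_prod_gt0 (s : seq L) :
  (0 < w (\prod_(x <- s) x)%R)%E -> exists2 x, x \in s & (0 < w x)%E.
Proof.
elim: s => [|x s IH]; first by rewrite big_nil val1 ltxx.
rewrite big_cons valM; have [wx _|wx h] := ltP 0%E (w x).
  by exists x; rewrite ?mem_head.
have [|y ys wy] := IH; last by exists y; rewrite // in_cons ys orbT.
by rewrite ltNge; apply: contraTN h => h; rewrite -leNgt adde_le0.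
Qed.

(** Reduction on the valuation ring, where it is a ring morphism; the map
[reduction] is its extension to the field by a default value. *)
Definition res : val_ring w -> residue w := \pi_(residue w)%qT.

HB.instance Definition _ := GRing.RMorphism.on res.

Lemma res_eq0 (x : val_ring w) : (res x == 0) = (0 < w (val x))%E.
Proof.
by rewrite -(rmorph0 res) /res -Quotient.idealrBE subr0.
Qed.

Lemma res0 : res (0 : val_ring w) = 0.
Proof. exact: rmorph0. Qed.

Lemma res_eqP (x y : val_ring w) : res x = res y <-> (0 < w (val x - val y)%R)%E.
Proof.
rewrite -(rmorphB val) -res_eq0 rmorphB subr_eq0 /=.
by split=> /eqP.
Qed.

Lemma val_ring_eq0 (x : val_ring w) : (val x == 0) = (x == 0).
Proof. by rewrite -(inj_eq val_inj) rmorph0. Qed.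

Lemma val_ring_ge0 (x : val_ring w) : (0 <= w (val x))%E.
Proof. exact: valP x. Qed.

Lemma res_unitP (x : val_ring w) : reflect (w (val x) = 0%E) (res x != 0).
Proof.
rewrite res_eq0 -leNgt; apply: (iffP idP) => [h|->] //.
by apply/eqP; rewrite eq_le h val_ring_ge0.
Qed.

Lemma res_surj (t : residue w) : exists a : val_ring w, res a = t.
Proof. by exists (repr t); rewrite /res reprK. Qed.

Lemma reductionE (x : val_ring w) : reduction w (val x) = res x.
Proof. by rewrite /reduction valKd. Qed.

Lemma val_ring_lift x : (0 <= w x)%E -> exists y : val_ring w, val y = x.
Proof. by move=> x0; exists (ValRing (x0 : x \in in_val_ring w)). Qed.

Lemma reduction_eq0 x : (0 <= w x)%E -> (reduction w x == 0) = (0 < w x)%E.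
Proof. by move=> /val_ring_lift[y <-]; rewrite reductionE res_eq0. Qed.

Lemma reductionB x y : (0 <= w x)%E -> (0 <= w y)%E ->
  reduction w (x - y) = reduction w x - reduction w y.
Proof.
move=> /val_ring_lift[x' <-] /val_ring_lift[y' <-].
by rewrite -rmorphB !reductionE rmorphB.
Qed.

Lemma reductionX x n : (0 <= w x)%E -> reduction w (x ^+ n) = reduction w x ^+ n.
Proof.
by move=> /val_ring_lift[x' <-]; rewrite -rmorphXn !reductionE rmorphXn.
Qed.

Lemma reduction_eqP x y : (0 <= w x)%E -> (0 <= w y)%E ->
  reduction w x = reduction w y <-> (0 < w (x - y)%R)%E.
Proof.
move=> x0 y0; rewrite -reduction_eq0 ?val_sub_ge // reductionB // subr_eq0.
by split=> /eqP.
Qed.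

Lemma res_natr_neq0 n : (n%:R != 0 :> residue w) = (w n%:R == 0%E).
Proof.
rewrite -(rmorph_nat res) res_eq0 rmorph_nat -leNgt eq_le val_nat andbT.
by [].
Qed.

End Valuation.

(** Factoring P into linear factors, P(z) is the product of the z - r; if it has
positive valuation, so has one of the factors. *)
Lemma root_near (L : closedFieldType) (w : valuation L) (P : {poly L}) z :
  P \is monic -> (0 < w P.[z])%E -> exists2 r, root P r & (0 < w (z - r)%R)%E.
Proof.
move=> mP; have [s Ps] := closed_field_poly_normal P.
rewrite {1}Ps (monicP mP) scale1r horner_prod => h.
have [|x /mapP[r rs ->] wx] := @val_sum_prod_gt0 _ w [seq ('X - r%:P).[z] | r <- s].
  by rewrite big_map.
exists r; last by rewrite hornerXsubC in wx.
by rewrite Ps (monicP mP) scale1r root_prod_XsubC.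
Qed.

(** * Simple roots in closed subfields *)

Section Subfield.
Variables (L : fieldType) (E : set L) (clE : divring_closed (mem E)).

Lemma subfield1 : E 1.
Proof. by case: clE => h _ _; apply/set_mem. Qed.

Lemma subfieldB x y : E x -> E y -> E (x - y).
Proof. by case: clE => _ h _ Ex Ey; apply/set_mem/h; apply/mem_set. Qed.

Lemma subfield0 : E 0.
Proof. by rewrite -(subrr 1); apply: subfieldB; exact: subfield1. Qed.

Lemma subfieldD x y : E x -> E y -> E (x + y).
Proof.
move=> Ex Ey; rewrite -[y]opprK -[- y]sub0r; apply: subfieldB => //.
by apply: subfieldB => //; exact: subfield0.
Qed.

Lemma subfield_div x y : E x -> E y -> E (x / y).
Proof. by case: clE => _ _ h Ex Ey; apply/set_mem/h; apply/mem_set. Qed.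

Lemma subfieldM x y : E x -> E y -> E (x * y).
Proof.
move=> Ex Ey; rewrite -[y]invrK -[y^-1]div1r; apply: subfield_div => //.
by apply: subfield_div => //; exact: subfield1.
Qed.

Lemma subfieldX x n : E x -> E (x ^+ n).
Proof.
move=> Ex; elim: n => [|n IH]; first exact: subfield1.
by rewrite exprS; exact: subfieldM.
Qed.

Lemma subfieldMn x n : E x -> E (x *+ n).
Proof.
move=> Ex; elim: n => [|n IH]; first exact: subfield0.
by rewrite mulrS; exact: subfieldD.
Qed.

Lemma subfield_horner (p : {poly L}) x : (forall i, E p`_i) -> E x -> E p.[x].
Proof.
move=> Ep Ex; rewrite horner_coef; elim/big_ind: _ => [|u v|i _].
- exact: subfield0.
- exact: subfieldD.
- by apply: subfieldM => //; exact: subfieldX.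
Qed.

End Subfield.

Definition valuation_closed (L : fieldType) (w : valuation L) (E : set L) :=
  forall y, (forall M : rat, exists2 x, E x & (M%:E <= w (x - y)%R)%E) -> E y.

Lemma taylor2 (R : comNzRingType) (P : {poly R}) (x y : R) :
  exists q, P.[y] = P.[x] + P^`().[x] * (y - x) + q * (y - x) ^+ 2.
Proof.
have /factor_theorem[Q1 Q1E] : root (P - P.[x]%:P) x.
  by rewrite rootE !hornerE subrr.
have /factor_theorem[Q2 Q2E] : root (Q1 - Q1.[x]%:P) x.
  by rewrite rootE !hornerE subrr.
have PE : P = P.[x]%:P + Q1 * ('X - x%:P) by rewrite -Q1E addrC subrK.
have Q1y : Q1.[y] = Q1.[x] + Q2.[y] * (y - x).
  have : Q1 = Q1.[x]%:P + Q2 * ('X - x%:P) by rewrite -Q2E addrC subrK.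
  by move=> /(congr1 (fun q => q.[y])); rewrite !hornerE.
exists Q2.[y].
have -> : P^`().[x] = Q1.[x].
  rewrite PE !derivE hornerD hornerC !hornerE /=.
  by rewrite ?hornerE subrr mulr0 add0r.
rewrite {1}PE !hornerE Q1y.
by rewrite mulrDl addrA.
Qed.

Section Newton.
Variables (L : fieldType) (w : valuation L) (E : set L).
Hypotheses (clE : divring_closed (mem E)) (cvE : valuation_closed w E).

(** Newton's iteration starting from x stays in E and converges to y: by the
second-order Taylor formula each step at least doubles the valuation of the
distance to y. As y is given in advance, closedness of E puts it in E. *)
Lemma simple_root_mem (P : {poly val_ring w}) (x y : val_ring w) :
  (forall i, E (val P`_i)) -> root P y -> res P^`().[y] != 0 ->
  E (val x) -> res x = res y -> E (val y).
Proof.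
move=> EP Py P'y Ex xy.
have [<- //|/eqP neq_xy] := pselect (x = y).
have : val x - val y != 0 by rewrite subr_eq0 (inj_eq val_inj).
move=> /(val_fin w)[r wr].
have r_gt0 : 0 < r.
  by rewrite -lte_fin -wr; apply/res_eqP.
have step (n : nat) : exists z : val_ring w,
    [/\ E (val z), res z = res y & ((r *+ n.+1)%:E <= w (val z - val y)%R)%E].
  elim: n => [|n [z [Ez zy wz]]]; first by exists x; rewrite wr.
  have P'z : w (val P^`().[z]) = 0%E.
    by apply/res_unitP; rewrite -horner_map /= zy horner_map.
  pose u := val z - val P.[z] / val P^`().[z].
  (* Newton step: the first-order terms cancel because P(y) = 0. *)
  have uy : exists2 q, u - val y = (val z - val y) ^+ 2 * q & (0 <= w q)%E.
    have [q qE] := taylor2 P z y.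
    exists (val q / val P^`().[z]); last first.
      by apply: val_mul_ge0; rewrite ?(val_inv P'z) ?oppr0 //; exact: val_ring_ge0.
    have {}qE : val P.[z] =
        - (val P^`().[z] * (val y - val z) + val q * (val y - val z) ^+ 2).
      move: qE; rewrite (rootP Py) -addrA => /esym/eqP; rewrite addr_eq0 => /eqP ->.
      by rewrite rmorphN rmorphD !rmorphM rmorphB.
    rewrite /u mulrA; apply: (mulIf (val0_neq0 P'z)).
    rewrite divfK ?(val0_neq0 P'z) // mulrBl mulrBl divfK ?(val0_neq0 P'z) // qE.
    ring.
  case: uy => q uyE q0.
  have zy0 : (0 < w (val z - val y)%R)%E.
    exact/res_eqP.
  have uy0 : (0 < w (u - val y)%R)%E by rewrite uyE val_mul_gt ?val_expr_gt0.
  have [t tE] : exists t : val_ring w, val t = u.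
    apply: val_ring_lift; rewrite -(subrK (val y) u).
    by apply: val_add_ge; [exact: ltW uy0|exact: val_ring_ge0].
  have Ehorner (Q : {poly val_ring w}) : (forall i, E (val Q`_i)) -> E (val Q.[z]).
    move=> EQ; rewrite -horner_map; apply: subfield_horner => // i.
    by rewrite coef_map; exact: EQ.
  exists t; split.
  - rewrite tE; apply: subfieldB => //; apply: subfield_div => //.
      exact: Ehorner.
    apply: Ehorner => // i.
    by rewrite coef_deriv rmorphMn; apply: (subfieldMn clE); exact: EP.
  - by apply/res_eqP; rewrite tE.
  - rewrite tE uyE; apply: val_mul_ge => //; rewrite expr2 valM.
    apply: le_trans (leeD wz wz); rewrite -EFinD lee_fin -mulrnDr addSn.
    by rewrite ler_wpMn2l ?ltW // addnS !ltnS leq_addr.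
apply: cvE => M; have [n nE] : exists n, M <= r *+ n.+1.
  exists (Num.bound `|M / r|); rewrite -mulr_natl -ler_pdivrMr //.
  apply: le_trans (ler_norm _) _; apply: ltW.
  by apply: lt_trans (archi_boundP (normr_ge0 _)) _; rewrite ltr_nat.
have [z [Ez _ wz]] := step n; exists (val z) => //.
by apply: le_trans wz; rewrite lee_fin.
Qed.
End Newton.

(** * Spans of almost orthogonal families are complete *)

Section Extension.
Variables (K : fieldType) (v : valuation K) (L : fieldType) (w : valuation L).
Variables (iota : {rmorphism K -> L}) (ext : extends_valuation v w iota).

Definition span (d : nat) (b : 'I_d -> L) : set L :=
  [set x | exists a : 'I_d -> K, x = \sum_i iota (a i) * b i].

(** Up to the factor encoded by C, the valuation of a linear combination
controls those of its coefficients; an orthonormal family has C = 0. *)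
Definition norm_bounded (d : nat) (b : 'I_d -> L) (C : rat) : Prop :=
  forall (a : 'I_d -> K) i,
    (w (\sum_j iota (a j) * b j)%R <= v (a i) + C%:E)%E.

Lemma val_archi x : (forall n, (n%:R%:E <= w x)%E) -> x = 0.
Proof.
move=> h; apply/eqP; apply: contraT => /(val_fin w)[r wr].
have := h (Num.bound `|r|); rewrite wr lee_fin leNgt.
by rewrite (le_lt_trans (ler_norm r)) // archi_boundP.
Qed.

Lemma val_limit_unique x y :
  (forall M : rat, (M%:E <= w (x - y)%R)%E) -> x = y.
Proof. by move=> h; apply/eqP; rewrite -subr_eq0; apply/eqP/val_archi. Qed.

Section Complete.
Hypothesis complete : complete_valuation v.
Variables (d : nat) (b : 'I_d -> L) (C : rat).
Hypotheses (b_ge0 : forall i, (0 <= w (b i))%E) (bC : norm_bounded b C).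
Let S (a : 'I_d -> K) := \sum_i iota (a i) * b i.

Lemma spanB a a' : S a - S a' = S (fun i => a i - a' i).
Proof. by rewrite -sumrB; apply: eq_bigr => i _; rewrite rmorphB mulrBl. Qed.

(** The coefficients of a Cauchy sequence are Cauchy sequences in K. *)
Lemma span_complete (A : nat -> 'I_d -> K) :
  (forall M : rat, exists N, forall i j, (N <= i)%N -> (N <= j)%N ->
     (M%:E <= w (S (A i) - S (A j))%R)%E) ->
  exists a, forall M : rat, exists N, forall i, (N <= i)%N ->
     (M%:E <= w (S (A i) - S a)%R)%E.
Proof.
move=> cauchy.
have lim k : exists y, forall M : rat, exists N, forall i, (N <= i)%N ->
     (M%:E <= v (A i k - y)%R)%E.
  apply: complete => M; have [N NP] := cauchy (M + C).
  exists N => i j Ni Nj; have := NP i j Ni Nj; rewrite spanB => h.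
  have := le_trans h (bC _ k).
  by rewrite EFinD leeD2rE.
have [a aP] := choice lim.
exists a => M; have [N NP] := choice (fun k => aP k M).
exists (\max_k N k)%N => i Ni; rewrite spanB; apply: val_sum_ge => k _.
rewrite val_mul_ge // ext; apply: NP; apply: leq_trans Ni.
exact: leq_bigmax.
Qed.

Lemma span_closed : valuation_closed w (span b).
Proof.
move=> y approx.
have [x xP] := choice (fun n => let: ex_intro2 x p q := approx n%:R in
   ex_intro (fun x => span b x /\ (n%:R%:E <= w (x - y)%R)%E) x (conj p q)).
have [A AE] := choice (fun n => (xP n).1).
have wA n : (n%:R%:E <= w (S (A n) - y)%R)%E by rewrite /S -AE; case: (xP n).
have bnd (M : rat) i : (Num.bound `|M| <= i)%N -> (M%:E <= w (S (A i) - y)%R)%E.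
  move=> Mi; apply: le_trans (wA i); rewrite lee_fin.
  apply: le_trans (ler_norm M) _; apply: ltW.
  by apply: lt_le_trans (archi_boundP (normr_ge0 _)) _; rewrite ler_nat.
have [M|a aP] := @span_complete A.
  exists (Num.bound `|M|) => i j iM jM.
  rewrite (_ : S _ - _ = (S (A i) - y) - (S (A j) - y)); last by ring.
  by apply: val_sub_ge; apply: bnd.
exists a; apply: val_limit_unique => M.
have [N NP] := aP M; set n := maxn N (Num.bound `|M|).
rewrite (_ : y - _ = (S (A n) - S a) - (S (A n) - y)); last by rewrite /S; ring.
by apply: val_sub_ge; [apply: NP | apply: bnd]; rewrite ?leq_maxl ?leq_maxr.
Qed.

End Complete.

End Extension.

(** * Adjoining one element, and lifting from the residue field *)

Section Adjunction.
Variables (K L : fieldType) (iota : {rmorphism K -> L}).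

Lemma adjoined_root z : adjoined iota z z.
Proof. by exists 'X; rewrite map_polyX hornerX. Qed.

Lemma adjoined_base z c : adjoined iota z (iota c).
Proof. by exists c%:P; rewrite map_polyC hornerC. Qed.

Lemma adjoined_span (z : L) (G : {poly K}) x :
  G \is monic -> root (map_poly iota G) z ->
  adjoined iota z x <-> span iota (fun i : 'I_(size G).-1 => z ^+ i) x.
Proof.
move=> mG Gz; split=> [[q ->]|[a ->]]; last first.
  exists (\poly_(i < (size G).-1) (if insub i is Some j then a j else 0)).
  rewrite (@horner_coef_wide _ (size G).-1); last first.
    by rewrite (leq_trans (size_poly _ _)) // (leq_trans (size_poly _ _)).
  apply: eq_bigr => i _; rewrite coef_map coef_poly ltn_ord valK //.
have G0 := monic_neq0 mG.
exists (fun i => (q %% G)`_i).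
rewrite {1}(divp_eq q G) rmorphD rmorphM hornerD hornerM (rootP Gz) mulr0 add0r.
rewrite (@horner_coef_wide _ (size G).-1).
  by apply: eq_bigr => i _; rewrite coef_map.
by rewrite size_map_poly -ltnS prednK ?ltn_modp // size_poly_gt0.
Qed.

(** K[z] is the image of the abstract field generated by z over K. *)
Lemma adjoined_field z (G : {poly K}) : G != 0 -> root (map_poly iota G) z ->
  divring_closed (mem (adjoined iota z : set L)).
Proof.
move=> G0 Gz; have sub x : x \in (adjoined iota z : set L) <->
    exists u : subFExtend iota z G, subfx_inj u = x.
  rewrite inE; split=> [[q ->]|[u <-]].
    by exists (subfx_eval iota z G q); rewrite subfx_inj_eval.
  by have [q ->] := subfxE u; exists q; rewrite subfx_inj_eval.
split=> [|x y /sub[u <-] /sub[t <-]|x y /sub[u <-] /sub[t <-]]; apply/sub.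
- by exists 1; rewrite rmorph1.
- by exists (u - t); rewrite rmorphB.
- by exists (u / t); rewrite fmorph_div.
Qed.

Lemma adjoined_trans z t x :
  adjoined iota z t -> adjoined iota t x -> adjoined iota z x.
Proof.
move=> [q ->] [r ->]; exists (r \Po q).
by rewrite map_comp_poly horner_comp.
Qed.

End Adjunction.

Section Lift.
Variables (K : fieldType) (v : valuation K).

Lemma poly_lift (q : {poly residue v}) : exists2 p : {poly val_ring v},
  map_poly (@res _ v) p = q & (size p <= size q)%N.
Proof.
have [s sP] := choice (@res_surj _ v).
exists (\poly_(i < size q) s q`_i); last exact: size_poly.
apply/polyP => i; rewrite coef_map coef_poly; case: ltnP => [_|h] /=.
  exact: sP.
by rewrite rmorph0 nth_default.
Qed.

(** The leading term is kept apart, so that only the rest of q is lifted. *)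
Lemma monic_lift (q : {poly residue v}) : q \is monic ->
  exists2 p : {poly val_ring v}, map_poly (@res _ v) p = q & p \is monic.
Proof.
move=> mq; set n := (size q).-1.
have sq : size q = n.+1 by rewrite prednK // size_poly_gt0 monic_neq0.
have [p pq ps] := poly_lift (q - 'X^n).
have pn : (size p < size ('X^n : {poly val_ring v}))%N.
  rewrite size_polyXn; apply: leq_ltn_trans ps _; rewrite ltnS.
  apply/leq_sizeP => j; rewrite leq_eqVlt => /orP[/eqP <-|nj].
    by rewrite coefB coefXn eqxx -[q`_n]/(lead_coef q) (monicP mq) subrr.
  by rewrite coefB coefXn gtn_eqF // nth_default ?subr0 // sq.
exists ('X^n + p); first by rewrite rmorphD /= map_polyXn pq addrC subrK.
by rewrite monicE lead_coefDl // lead_coefXn.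
Qed.

End Lift.

Section Residues.
Variables (K : fieldType) (v : valuation K) (L : fieldType) (w : valuation L).
Variables (iota : {rmorphism K -> L}) (ext : extends_valuation v w iota).

Fact val_ring_ext_subproof (x : val_ring v) : iota (val x) \in in_val_ring w.
Proof. by rewrite unfold_in ext; exact: val_ring_ge0. Qed.

Definition val_ring_ext (x : val_ring v) : val_ring w :=
  ValRing (val_ring_ext_subproof x).

Fact val_ring_ext_zmod : zmod_morphism val_ring_ext.
Proof. by move=> x y; apply: val_inj; rewrite /= !rmorphB. Qed.

Fact val_ring_ext_monoid : monoid_morphism val_ring_ext.
Proof.
by split=> [|x y]; apply: val_inj; rewrite /= ?rmorph1 ?rmorphM ?rmorph1.
Qed.

HB.instance Definition _ :=
  GRing.isZmodMorphism.Build _ _ val_ring_ext val_ring_ext_zmod.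
HB.instance Definition _ :=
  GRing.isMonoidMorphism.Build _ _ val_ring_ext val_ring_ext_monoid.

Lemma residue_embeddingE (x : val_ring v) :
  residue_embedding w iota (res x) = res (val_ring_ext x).
Proof.
rewrite /residue_embedding -[iota _]/(val (val_ring_ext (repr (res x)))) reductionE.
apply/res_eqP; rewrite /= -rmorphB ext; apply/res_eqP.
by rewrite /res reprK.
Qed.

Fact residue_embedding_zmod :
  zmod_morphism (residue_embedding w iota : residue v -> _).
Proof.
move=> s t; have [x <-] := res_surj s; have [y <-] := res_surj t.
by rewrite -rmorphB !residue_embeddingE rmorphB rmorphB.
Qed.

Fact residue_embedding_monoid :
  monoid_morphism (residue_embedding w iota : residue v -> _).
Proof.
split=> [|s t].
  by rewrite -(rmorph1 (@res _ v)) residue_embeddingE !rmorph1.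
have [x <-] := res_surj s; have [y <-] := res_surj t.
by rewrite -rmorphM !residue_embeddingE rmorphM rmorphM.
Qed.

(** The same map as [residue_embedding], bundled with its morphism structure;
this depends on w extending v. *)
Definition residue_emb : {rmorphism residue v -> residue w} :=
  HB.pack (residue_embedding w iota : residue v -> residue w)
    (GRing.isZmodMorphism.Build _ _ _ residue_embedding_zmod)
    (GRing.isMonoidMorphism.Build _ _ _ residue_embedding_monoid).

Lemma residue_embE (x : val_ring v) : residue_emb (res x) = res (val_ring_ext x).
Proof. exact: residue_embeddingE. Qed.

End Residues.

(** * Unramified generators *)

Section Generators.
Variables (K : fieldType) (v : valuation K) (L : fieldType) (w : valuation L).
Variables (iota : {rmorphism K -> L}) (ext : extends_valuation v w iota).

Local Notation lift := (val_ring_ext ext).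
Local Notation emb := (residue_emb ext).

(** The polynomial g is a lift of the minimal polynomial of the reduction of
theta, of the same degree. *)
Definition unramified_generator (theta : val_ring w) : Prop :=
  separable_over emb (res theta) /\
  exists g : {poly val_ring v},
    [/\ g \is monic, irreducible_poly (map_poly (@res _ v) g)
      & root (map_poly lift g) theta].

Lemma map_lift_val (q : {poly val_ring v}) (x : val_ring w) :
  (map_poly iota (map_poly val q)).[val x] = val (map_poly lift q).[x].
Proof.
rewrite -horner_map -!map_poly_comp; congr (_.[_]).
Qed.

Lemma res_lift_horner (q : {poly val_ring v}) (x : val_ring w) :
  res (map_poly lift q).[x] = (map_poly emb (map_poly (@res _ v) q)).[res x].
Proof.
rewrite -horner_map -!map_poly_comp; congr (_.[_]).
by apply: eq_map_poly => a; exact/esym/residue_embE.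
Qed.

Lemma root_reduction (q : {poly val_ring v}) (x : val_ring w) :
  root (map_poly lift q) x ->
  root (map_poly emb (map_poly (@res _ v) q)) (res x).
Proof. by move=> /rootP qx; rewrite rootE -res_lift_horner qx res0. Qed.

Section Generator.
Variables (theta : val_ring w) (g : {poly val_ring v}).
Hypotheses (mg : g \is monic) (ig : irreducible_poly (map_poly (@res _ v) g)).
Hypothesis gtheta : root (map_poly lift g) theta.
Let G : {poly K} := map_poly val g.

Let mG : G \is monic. Proof. exact: monic_map. Qed.

Let Gtheta : root (map_poly iota G) (val theta).
Proof. by rewrite rootE map_lift_val (rootP gtheta) rmorph0. Qed.

Let powers (i : 'I_(size G).-1) := val theta ^+ i.

Let powers_ge0 i : (0 <= w (powers i))%E.
Proof. by apply: val_expr_ge0; exact: val_ring_ge0. Qed.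

(** After division by a coefficient of least valuation, a combination of too
large valuation would reduce to a nonzero polynomial that vanishes at the
reduction of theta and has degree smaller than its minimal polynomial. *)
Lemma generator_orthogonal : norm_bounded v w iota powers 0.
Proof.
move=> a i; rewrite adde0.
have [i0 min0] := @val_min _ v _ i a.
apply: le_trans (min0 i).
have [a0|a0] := eqVneq (a i0) 0; first by rewrite a0 val0 leey.
have [r vr] := val_fin v a0.
rewrite leNgt; apply/negP => lt0.
have b_int j : exists b : val_ring v, val b = a j / a i0.
  apply: val_ring_lift.
  have [->|aj] := eqVneq (a j) 0; first by rewrite mul0r val0 leey.
  have [s vs] := val_fin v aj; rewrite (val_div vs vr) lee_fin subr_ge0.
  by rewrite -lee_fin -vr -vs.
have [b bE] := choice b_int.
pose q := \poly_(j < (size G).-1) (if insub j is Some k then b k else 0).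
have qE : val (map_poly lift q).[theta] =
    (\sum_j iota (a j) * powers j) / iota (a i0).
  rewrite -map_lift_val (@horner_coef_wide _ (size G).-1); last first.
    rewrite (leq_trans (size_poly _ _)) // (leq_trans (size_poly _ _)) //.
    exact: size_poly.
  rewrite mulr_suml; apply: eq_bigr => j _.
  rewrite !coef_map coef_poly ltn_ord valK /= bE fmorph_div.
  by rewrite -!mulrA; congr (_ * _); rewrite mulrC.
have q_root : root (map_poly emb (map_poly (@res _ v) q)) (res theta).
  rewrite rootE -res_lift_horner res_eq0 qE valM -ext in vr *.
  move: lt0; rewrite -ext (val_inv vr) vr.
  case: (w _) => //= s; rewrite -EFinD !lte_fin.
  by rewrite subr_gt0.
have g_root : root (map_poly emb (map_poly (@res _ v) g)) (res theta).
  exact: root_reduction.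
have q_neq0 : map_poly (@res _ v) q != 0.
  apply/eqP => /(congr1 (fun p : {poly _} => p`_i0)).
  rewrite coef0 coef_map coef_poly ltn_ord valK.
  by move=> /eqP; rewrite res_eq0 bE divff // val1 ltxx.
have := proj2 (subfx_irreducibleP g_root (irredp_neq0 ig)) ig _ q_root q_neq0.
rewrite size_map_poly_id0; last by rewrite (monicP mg) rmorph1 oner_neq0.
rewrite leqNgt => /negP; apply.
apply: leq_ltn_trans (size_poly _ _) (leq_ltn_trans (size_poly _ _) _).
rewrite size_map_poly_id0; last by rewrite (monicP mg) rmorph1 oner_neq0.
by rewrite ltn_predL size_poly_gt0 monic_neq0.
Qed.

Lemma generator_closed : complete_valuation v ->
  valuation_closed w (adjoined iota (val theta) : set L).
Proof.
move=> complete; have := span_closed ext complete powers_ge0 generator_orthogonal.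
move=> h y hy; apply/(adjoined_span _ mG Gtheta); apply: h => M.
by have [x /(adjoined_span _ mG Gtheta) ? ?] := hy M; exists x.
Qed.

Lemma generator_subfield : divring_closed (mem (adjoined iota (val theta) : set L)).
Proof. exact: adjoined_field (monic_neq0 mG) Gtheta. Qed.

(** By orthogonality the valuation of x is that of one of its coefficients. *)
Lemma generator_value x : adjoined iota (val theta) x -> x != 0 ->
  exists2 a, a != 0 & v a = w x.
Proof.
move=> /(adjoined_span _ mG Gtheta)[a aE] x0.
have [i0] : exists i0 : 'I_(size G).-1, True.
  case: (size G).-1 a aE => [|n] a aE; last by exists ord0.
  by rewrite aE big_ord0 eqxx in x0.
move=> _; have [i] := @val_sum_min _ w _ i0 (fun i => iota (a i) * powers i).
rewrite -aE => le1; have le2 : (w x <= v (a i))%E.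
  by have := generator_orthogonal a i; rewrite adde0 -aE.
have le3 : (v (a i) <= w (iota (a i) * powers i)%R)%E.
  by rewrite valM ext leeDl.
have vx : v (a i) = w x by apply/eqP; rewrite eq_le le2 andbT (le_trans le3).
by exists (a i) => //; rewrite -(val_eqy v) vx val_eqy.
Qed.

Lemma generator_residue x : adjoined iota (val theta) (val x) ->
  adjoined emb (res theta) (res x).
Proof.
move=> /(adjoined_span _ mG Gtheta)[a aE].
have b_int i : exists b : val_ring v, val b = a i.
  apply: val_ring_lift; have := generator_orthogonal a i.
  by rewrite adde0 -aE; apply: le_trans; exact: val_ring_ge0.
have [b bE] := choice b_int.
pose q := \poly_(j < (size G).-1) (if insub j is Some k then b k else 0).
exists (map_poly (@res _ v) q); rewrite -res_lift_horner; congr res; apply: val_inj.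
rewrite -map_lift_val (@horner_coef_wide _ (size G).-1); last first.
  rewrite (leq_trans (size_poly _ _)) // (leq_trans (size_poly _ _)) //.
  exact: size_poly.
rewrite aE; apply: eq_bigr => j _.
by rewrite !coef_map coef_poly ltn_ord valK /= bE.
Qed.

End Generator.

End Generators.

(** * The maximal unramified extension *)

Section MaximalUnramified.
Variables (K : fieldType) (v : valuation K) (L : closedFieldType) (w : valuation L).
Variables (iota : {rmorphism K -> L}) (ext : extends_valuation v w iota).
Hypothesis complete : complete_valuation v.

Local Notation lift := (val_ring_ext ext).
Local Notation emb := (residue_emb ext).

(** A monic lift of the minimal polynomial of t splits in L, and its value at a
lift z of t has positive valuation, so one of its roots is close to z. *)
Lemma generator_exists (t : residue w) : separable_over emb t ->
  exists2 theta, unramified_generator ext theta & res theta = t.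
Proof.
move=> st; have [P [iP _ Pt]] := st.
have lc0 : (lead_coef P)^-1 != 0 by rewrite invr_eq0 lead_coef_eq0 irredp_neq0.
pose P1 := (lead_coef P)^-1 *: P.
have P1P : P1 %= P by exact: eqp_scale.
have mP1 : P1 \is monic by rewrite monicE lead_coefZ mulVf // -invr_eq0.
have [g gP1 mg] := monic_lift mP1.
have [z zt] := res_surj t.
have mgL : map_poly val (map_poly lift g) \is monic by rewrite !monic_map.
have P1t : root (map_poly emb P1) t by rewrite map_polyZ rootZ // fmorph_eq0.
have [|r gr zr] := @root_near _ w _ (val z) mgL.
  by rewrite horner_map /= -res_eq0 res_lift_horner gP1 zt -/(root _ _).
have [y yr] : exists y : val_ring w, val y = r.
  apply: val_ring_lift; rewrite -[r](subKr (val z)) val_sub_ge ?val_ring_ge0 //.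
  exact: ltW.
have yt : res y = t by rewrite -zt; apply/esym/res_eqP; rewrite yr.
exists y; last exact: yt.
split; first by rewrite yt.
exists g; split=> //.
  rewrite gP1; split; first by rewrite (eqp_size P1P); case: iP.
  move=> q sq; rewrite (eqp_dvdr _ P1P) => /(apply_irredp iP sq) qP.
  by apply: eqp_trans qP _; rewrite eqp_sym.
by move: gr; rewrite -yr rootE horner_map val_ring_eq0.
Qed.

Lemma adjoined_lift (theta y : val_ring w) (P : {poly val_ring w}) :
  unramified_generator ext theta ->
  (forall i, adjoined iota (val theta) (val P`_i)) ->
  root P y -> res P^`().[y] != 0 -> adjoined emb (res theta) (res y) ->
  adjoined iota (val theta) (val y).
Proof.
move=> [_ [g [mg ig gt]]] EP Py P'y [q qE].
have [p pq _] := poly_lift q.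
apply: (@simple_root_mem _ w (adjoined iota (val theta)) _ _ P
          (map_poly lift p).[theta]) => //.
- exact: generator_subfield mg gt.
- exact: generator_closed mg ig gt complete.
- by exists (map_poly val p); rewrite map_lift_val.
- by rewrite res_lift_horner pq.
Qed.

(** The maximal unramified extension of K in L. That this union of fields is a
field rests on the primitive element theorem for residue fields. *)
Definition max_unramified : set L :=
  [set x | exists2 theta, unramified_generator ext theta
                        & adjoined iota (val theta) x].

Lemma generator_simple_root (theta : val_ring w) :
  unramified_generator ext theta ->
  exists g : {poly val_ring v}, root (map_poly lift g) theta /\
     res (map_poly lift g)^`().[theta] != 0.
Proof.
move=> [st [g [mg ig gt]]]; exists g; split => //.
rewrite deriv_map res_lift_horner -(deriv_map (@res _ v)) -(deriv_map emb).
by apply: separable_over_deriv => //; exact: root_reduction.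
Qed.

Lemma adjoined_generator (theta eta : val_ring w) :
  unramified_generator ext theta -> unramified_generator ext eta ->
  adjoined emb (res theta) (res eta) ->
  adjoined iota (val theta) (val eta).
Proof.
move=> gt ge te; have [g [g0 g'0]] := generator_simple_root ge.
apply: (adjoined_lift gt _ g0 g'0 te) => i.
by rewrite coef_map; exact: adjoined_base.
Qed.

Lemma max_unramified_pair x y : max_unramified x -> max_unramified y ->
  exists theta, [/\ unramified_generator ext theta,
     adjoined iota (val theta) x & adjoined iota (val theta) y].
Proof.
move=> [t1 g1 x1] [t2 g2 y2].
have [z [sz z1 z2]] := separable_over_pair g1.1 g2.1.
have [theta gt tz] := generator_exists sz; subst z.
exists theta; split=> //.
  by apply: adjoined_trans x1; exact: adjoined_generator.
by apply: adjoined_trans y2; exact: adjoined_generator.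
Qed.

Lemma max_unramified_base a : max_unramified (iota a).
Proof.
have s0 : separable_over emb 0.
  exists 'X; split.
  - by rewrite -[X in irreducible_poly X]subr0; exact: irredp_XsubC.
  - by rewrite unlock derivX coprimep1.
  - by rewrite map_polyX rootX.
have [theta gt _] := generator_exists s0.
by exists theta => //; exact: adjoined_base.
Qed.

Lemma max_unramified_subfield : divring_closed (mem max_unramified).
Proof.
split=> [|x y|x y]; rewrite !inE.
- by rewrite -(rmorph1 iota); exact: max_unramified_base.
- move=> Ux Uy; have [theta [gt tx ty]] := max_unramified_pair Ux Uy.
  have [_ [g [mg ig rt]]] := gt.
  by exists theta => //; apply: subfieldB => //; exact: generator_subfield mg rt.
- move=> Ux Uy; have [theta [gt tx ty]] := max_unramified_pair Ux Uy.
  have [_ [g [mg ig rt]]] := gt.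
  by exists theta => //; apply: subfield_div => //; exact: generator_subfield mg rt.
Qed.

Lemma max_unramified_value x : max_unramified x -> x != 0 ->
  exists2 a, a != 0 & v a = w x.
Proof.
move=> [theta [_ [g [mg ig rt]]] tx] x0; exact: generator_value mg ig rt x tx x0.
Qed.

Lemma max_unramified_residue x : max_unramified x -> (0 <= w x)%E ->
  separable_over emb (reduction w x).
Proof.
move=> [theta [st [g [mg ig rt]]] tx] x0.
have [y yx] := val_ring_lift x0; rewrite -yx reductionE.
apply: separable_over_adjoined st _; apply: (generator_residue mg ig rt).
by rewrite yx.
Qed.

(** The reduction of y is an l-th root of a separable element, hence separable.
If K[theta] contains y^l and its residue field contains the reduction of y,
then y is a simple root of X^l - y^l modulo the maximal ideal, so y lies in
K[theta]. *)
Lemma max_unramified_rootn l y : w l%:R = 0%E -> (0 < l)%N ->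
  max_unramified (y ^+ l) -> w (y ^+ l) = 0%E -> max_unramified y.
Proof.
move=> wl l0 [t gt ty] wy.
have wy0 := val_root l0 wy.
have [z zy] : exists z : val_ring w, val z = y by apply: val_ring_lift; rewrite wy0.
subst y.
have l_neq0 : l%:R != 0 :> residue v.
  rewrite -(fmorph_eq0 emb) rmorph_nat res_natr_neq0 wl //.
have zl0 : res z ^+ l != 0 by rewrite -rmorphXn; apply/res_unitP; rewrite rmorphXn.
have [st [g [mg ig rt]]] := gt.
have szl : adjoined emb (res t) (res z ^+ l).
  by rewrite -rmorphXn; apply: (generator_residue mg ig rt); rewrite rmorphXn.
have sz := separable_over_rootn l_neq0 zl0 (separable_over_adjoined st szl) erefl.
have [u [su ut uz]] := separable_over_pair st sz.
have [theta gth tu] := generator_exists su; subst u.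
exists theta => //; apply: (@adjoined_lift theta z ('X^l - (z ^+ l)%:P)) => //.
- have [_ [h [mh _ rh]]] := gth; have clE := generator_subfield mh rh.
  move=> i; rewrite coefB coefXn coefC rmorphB; apply: subfieldB => //.
    case: (i == l); rewrite ?rmorph1 ?rmorph0; first exact: subfield1.
    exact: subfield0.
  case: (i == 0)%N; last by rewrite rmorph0; exact: subfield0.
  rewrite rmorphXn; apply: adjoined_trans ty.
  exact: adjoined_generator.
- by rewrite rootE !hornerE subrr.
- rewrite derivB derivXn derivC subr0 hornerMn hornerXn.
  apply/res_unitP; rewrite rmorphMn rmorphXn /= -mulr_natr valM val_expr0 //.
  by rewrite wl adde0.
Qed.

End MaximalUnramified.

(** * The extension generated by an l-th root of a uniformizer *)

(** The term of least valuation dominates the sum of the others, as all of them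
have strictly larger valuation. *)
Lemma distinct_sum (L : fieldType) (w : valuation L) (I : finType) (F : I -> L) i :
  (forall j k, j != k -> F j != 0 -> w (F j) != w (F k)) ->
  (w (\sum_j F j)%R <= w (F i))%E.
Proof.
move=> neqF; have [i0 min0] := val_min w i F.
have [F0|F0] := eqVneq (F i0) 0.
  suff -> : F i = 0 by rewrite val0 leey.
  by apply/eqP; rewrite -(val_eqy w) -leye_eq -(val0 w) -F0.
have [r wr] := val_fin w F0.
suff -> : w (\sum_j F j) = w (F i0) by [].
rewrite (bigD1 i0) //= val_add_lt // val_sum_gt ?wr ?ltey // => j ji0.
by rewrite -wr lt_neqAle min0 andbT neqF // eq_sym.
Qed.

Section RadicalExtension.
Variables (K : fieldType) (v : valuation K) (L : fieldType) (w : valuation L).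
Variables (iota : {rmorphism K -> L}) (ext : extends_valuation v w iota).
Hypothesis complete : complete_valuation v.
Variables (g : rat) (g_gt0 : 0 < g).
Hypothesis vg : value_group v setT = range (fun m : int => g *~ m).
Variables (l : nat) (l_gt0 : (0 < l)%N) (pi : K) (varpi : L).
Hypotheses (v_pi : v pi = g%:E) (varpi_l : varpi ^+ l = iota pi).

Lemma value_multiple a : a != 0 -> exists m : int, v a = (g *~ m)%:E.
Proof.
move=> a0; have : value_group v setT (fine (v a)) by exists a.
rewrite vg => -[m _ mE]; exists m; rewrite mE.
by have [r ->] := val_fin v a0.
Qed.

Lemma value_varpi : w varpi = (g / l%:R)%:E.
Proof.
have p0 : varpi != 0.
  apply/eqP => p0; move: varpi_l; rewrite p0 expr0n eqn0Ngt l_gt0 /= => /esym/eqP.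
  by rewrite fmorph_eq0 -(val_eqy v) v_pi.
have [r wr] := val_fin w p0; rewrite wr; congr (_%:E).
have := val_expr l wr; rewrite varpi_l ext v_pi => -[->].
by rewrite -[r *+ l]mulr_natr mulfK // pnatr_eq0 -lt0n.
Qed.

Let G : {poly K} := 'X^l - pi%:P.
Let mG : G \is monic. Proof. exact: monicXnsubC. Qed.
Let sG : (size G).-1 = l. Proof. by rewrite size_XnsubC. Qed.
Let G0 : G != 0. Proof. exact: monic_neq0. Qed.
Let Gvarpi : root (map_poly iota G) varpi.
Proof. by rewrite rmorphB /= map_polyXn map_polyC rootE !hornerE varpi_l subrr. Qed.

(** K(varpi) as a type of its own, so that the theory of the maximal unramified
extension can be applied with this field as the base. *)
Definition radical_ext : fieldType := subFExtend iota varpi G.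
Definition radical_emb : {rmorphism radical_ext -> L} :=
  (subfx_inj : {rmorphism subFExtend iota varpi G -> L}).

Fact radical_eqy x : (w (radical_emb x) == +oo%E) = (x == 0).
Proof. by rewrite val_eqy fmorph_eq0. Qed.

Definition radical_val : valuation radical_ext.
Proof.
apply: (@Valuation _ (fun x => w (radical_emb x))).
- by move=> x; exact: val_neqNy.
- exact: radical_eqy.
- by move=> x y; rewrite rmorphM valM.
- by move=> x y; rewrite rmorphD; exact: val_ultra.
Defined.

Lemma radical_ext_val : extends_valuation radical_val w radical_emb.
Proof. by []. Qed.

Lemma adjoined_radical x : adjoined iota varpi x <-> exists u, radical_emb u = x.
Proof.
split=> [[q ->]|[u <-]].
  by exists (subfx_eval iota varpi G q); exact: subfx_inj_eval.
by have [q ->] := subfxE u; exists q; exact: subfx_inj_eval.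
Qed.

Let powers (i : 'I_(size G).-1) := varpi ^+ i.

(** Modulo l, the multiple of g / l on the right remembers the exponent i. *)
Lemma radical_term (a : K) (i : nat) : a != 0 ->
  exists2 m : int, v a = (g *~ m)%:E &
    w (iota a * varpi ^+ i) = ((g / l%:R) *~ (m * l + i))%:E.
Proof.
move=> /value_multiple[m vm]; exists m => //.
rewrite valM ext vm (val_expr i value_varpi) -EFinD; congr (_%:E).
have l0 : l%:R != 0 :> rat by rewrite pnatr_eq0 -lt0n.
rewrite -[g *~ m]mulrzr -[_ *+ i]mulr_natr -[RHS]mulrzr rmorphD rmorphM /=.
by rewrite -!pmulrn; field.
Qed.

(** Terms with different exponents of varpi have valuations that differ modulo
the value group of K. *)
Lemma radical_orthogonal (a : 'I_(size G).-1 -> K) i :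
  (w (\sum_j iota (a j) * powers j)%R <= w (iota (a i) * powers i)%R)%E.
Proof.
apply: distinct_sum => j k jk; rewrite mulf_eq0 negb_or fmorph_eq0 => /andP[aj _].
have [m vm ->] := radical_term j aj.
have [->|ak] := eqVneq (a k) 0; first by rewrite rmorph0 mul0r val0.
have [n vn ->] := radical_term k ak.
apply: contra jk => /eqP[] /(mulrIz _) => h.
have /h eqmn : g / l%:R != 0 by rewrite mulf_neq0 ?gt_eqF // invr_gt0 ltr0n.
apply/eqP/val_inj => /=.
have jl : (j < l)%N by rewrite -sG.
have kl : (k < l)%N by rewrite -sG.
have := congr1 (fun z => (z %% l)%Z) eqmn.
by rewrite !modzMDl !modz_nat !modn_small // => -[].
Qed.

Lemma radical_bounded : norm_bounded v w iota powers g.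
Proof.
move=> a i; apply: le_trans (radical_orthogonal a i) _.
rewrite valM ext leeD2l // (val_expr i value_varpi) lee_fin.
have il : (i < l)%N by rewrite -sG.
rewrite -[_ *+ i]mulr_natr mulrAC ler_pdivrMr ?ltr0n // ler_pM2l // ler_nat.
exact: ltnW.
Qed.

Lemma radical_complete : complete_valuation radical_val.
Proof.
move=> x cauchy.
have expand u : exists a : 'I_(size G).-1 -> K,
    radical_emb u = \sum_j iota (a j) * powers j.
  by apply/(adjoined_span _ mG Gvarpi)/adjoined_radical; exists u.
have [A AE] := choice (fun n => expand (x n)).
have p0 i : (0 <= w (powers i))%E.
  by apply: val_expr_ge0; rewrite value_varpi lee_fin divr_ge0 // ltW.
have [|a aP] := span_complete ext complete p0 radical_bounded (A := A).
  move=> M; have [N NP] := cauchy M; exists N => i j Ni Nj.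
  by rewrite -!AE -rmorphB; exact: NP.
have /adjoined_radical[y yE] : adjoined iota varpi (\sum_j iota (a j) * powers j).
  by apply/(adjoined_span _ mG Gvarpi); exists a.
exists y => M; have [N NP] := aP M; exists N => i Ni.
by have := NP i Ni; rewrite -AE -yE -rmorphB.
Qed.

Lemma radical_value (u : radical_ext) : u != 0 ->
  exists m : int, w (radical_emb u) = ((g / l%:R) *~ m)%:E.
Proof.
move=> u0; have ux0 : radical_emb u != 0 by rewrite fmorph_eq0.
have /(adjoined_span _ mG Gvarpi)[a aE] : adjoined iota varpi (radical_emb u).
  by apply/adjoined_radical; exists u.
have i0 : 'I_(size G).-1 by rewrite sG; exact: Ordinal l_gt0.
have [i] := @val_sum_min _ w _ i0 (fun i => iota (a i) * powers i).
rewrite -[\sum_j _]aE => le1.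
have wx : w (radical_emb u) = w (iota (a i) * powers i).
  by apply/eqP; rewrite eq_le le1 andbT {1}aE; exact: radical_orthogonal.
have [|m _ wm] := @radical_term (a i) i.
  apply: contraNneq ux0 => a0; move: wx; rewrite a0 rmorph0 mul0r val0 => /eqP.
  by rewrite val_eqy.
by exists (m * l + i); rewrite wx.
Qed.

Lemma radical_base c : exists u, radical_emb u = iota c.
Proof. by apply/adjoined_radical; exact: adjoined_base. Qed.

Lemma radical_varpi : exists u, radical_emb u = varpi.
Proof. by apply/adjoined_radical; exact: adjoined_root. Qed.

End RadicalExtension.

(** * Counting cosets of the value group *)

Section ValueCosets.
Variables (K : fieldType) (v : valuation K) (L : fieldType) (w : valuation L).
Variables (iota : {rmorphism K -> L}) (ext : extends_valuation v w iota).
Variables (g : rat) (g_gt0 : 0 < g).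
Hypothesis vg : value_group v setT = range (fun m : int => g *~ m).

Definition coset (q : rat) : set rat := [set q + h | h in value_group v setT].

Lemma coset_eqP q r : coset q = coset r <-> exists m : int, q - r = g *~ m.
Proof.
rewrite /coset vg; split=> [qr|[m qr]].
  have : [set q + h | h in range (fun m : int => g *~ m)] q.
    by exists 0; rewrite ?addr0 //; exists 0.
  rewrite qr => -[_ [m _ <-] <-]; exists m.
  by rewrite addrAC subrr add0r.
have qE : q = r + g *~ m by rewrite -qr addrC subrK.
rewrite eqEsubset; split=> [_ [_ [n _ <-] <-]|_ [_ [n _ <-] <-]].
  by exists (g *~ (m + n)); [exists (m + n)|rewrite qE mulrzDr addrA].
exists (g *~ (n - m)); first by exists (n - m).
by rewrite qE mulrzBr -addrA; congr (_ + _); rewrite addrC subrK.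
Qed.

Variables (l : nat) (l_gt0 : (0 < l)%N) (E : set L).
Hypotheses (clE : divring_closed (mem E)) (baseE : forall c, E (iota c)).
Hypothesis valE : forall x, E x -> x != 0 ->
  exists m : int, w x = ((g / l%:R) *~ m)%:E.

(** The integers m such that m g / l is a value on E form a group containing l;
if d generates it, the index is l / d. *)
Lemma ramification_index_dvd :
  exists2 e, ramification_index v w E e & (e %| l)%N.
Proof.
set h := g / l%:R.
have lQ : l%:R != 0 :> rat by rewrite pnatr_eq0 -lt0n.
have h0 : h != 0 by rewrite mulf_neq0 ?invr_eq0 // gt_eqF.
(* Values on E in units of h = g / l. *)
pose S (n : int) := exists x, [/\ E x, x != 0 & w x = (h *~ n)%:E].
have SB m n : S m -> S n -> S (m - n).
  move=> [x [Ex x0 wx]] [y [Ey y0 wy]]; exists (x / y); split.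
  - exact: subfield_div.
  - by rewrite mulf_neq0 ?invr_eq0.
  - by rewrite (val_div wx wy) mulrzBr.
have S0 : S 0 by exists 1; split; rewrite ?oner_neq0 ?val1 //; exact: subfield1.
have SM m (n : int) : S m -> S (m * n).
  move=> Sm; have SN k : S k -> S (- k) by rewrite -sub0r; apply: SB.
  have Snat (k : nat) : S (m * k%:Z).
    elim: k => [|k IH]; first by rewrite mulr0.
    rewrite -[k.+1]addn1 PoszD mulrDr mulr1 -[m in _ + m]opprK.
    by apply: SB => //; exact: SN.
  case: n => n; first exact: Snat.
  by rewrite NegzE mulrN; apply: SN.
have gl : g = h *~ l%:Z by rewrite -pmulrn -[RHS]mulr_natr divfK.
have Sl : S l%:Z.
  have : value_group v setT g by rewrite vg; exists 1.
  move=> [a [_ a0] va]; exists (iota a); split => //; first by rewrite fmorph_eq0.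
  by rewrite ext -gl -va; have [r ->] := val_fin v a0.
have exd : exists d : nat, (0 < d)%N && `[< S d%:Z >].
  by exists l; rewrite l_gt0; apply/asboolP.
case: (ex_minnP exd) => d /andP[d0 /asboolP Sd] mind.
have dvdS n : S n -> exists k, n = d%:Z * k.
  move=> Sn; exists (n %/ d)%Z.
  have r_ge0 : 0 <= (n %% d)%Z by rewrite modz_ge0 // gt_eqF.
  have r_lt : (n %% d)%Z < d%:Z by rewrite ltz_pmod.
  have Sr : S (n %% d)%Z.
    have -> : (n %% d)%Z = n - d%:Z * (n %/ d)%Z.
      by rewrite {2}(divz_eq n d) mulrC addrAC subrr add0r.
    by apply: SB => //; exact: SM.
  rewrite [LHS](divz_eq n d) mulrC -[RHS]addr0; congr (_ + _).
  move: r_ge0 r_lt Sr; case: (n %% d)%Z => // r _ r_lt Sr.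
  case: r r_lt Sr => // r; rewrite ltz_nat => r_lt Sr.
  have : (d <= r.+1)%N by apply: mind; apply/asboolP.
  by rewrite leqNgt r_lt.
have [e' le'] := dvdS _ Sl.
have [e le] : exists e : nat, l = (d * e)%N.
  by exists `|e'|%N; have := congr1 absz le'; rewrite abszM.
have e0 : (0 < e)%N by move: l_gt0; rewrite le muln_gt0 => /andP[].
exists e; last by rewrite le dvdn_mull.
rewrite /ramification_index.
pose phi (i : nat) := coset (h *~ (d * i)%N).
have -> : value_cosets v w E = [set phi i | i in `I_e].
  rewrite eqEsubset; split=> [_ [q [x [Ex x0] <-] <-]|_ [i ie <-]].
    have [n wx] : exists n : int, w x = (h *~ n)%:E by exact: valE.
    have [k nk] : exists k, n = d%:Z * k by apply: dvdS; exists x.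
    have k_ge0 : 0 <= (k %% e)%Z by rewrite modz_ge0 // gt_eqF.
    exists (`|(k %% e)%Z|%N).
      by rewrite /= -ltz_nat gez0_abs // ltz_pmod.
    apply/coset_eqP; exists (- (k %/ e)%Z).
    rewrite wx /= gl -mulrzA. rewrite -mulrzBr; congr (_ *~ _).
    rewrite PoszM gez0_abs // nk le PoszM {2}(divz_eq k e).
    ring.
  have [x [Ex x0 wx]] := SM _ i Sd.
  by exists (fine (w x)); [exists x|rewrite wx].
apply: inj_card_eq => i j; rewrite !inE /= => ie je /coset_eqP[m].
rewrite gl -mulrzA -mulrzBr le => /(mulrIz h0) /eqP.
have dZ : d%:Z != 0 by rewrite gt_eqF.
rewrite !PoszM -mulrBr -mulrA (inj_eq (mulfI dZ)) subr_eq => /eqP.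
move=> /(congr1 (fun z => (z %% e)%Z)).
by rewrite mulrC modzMDl !modz_nat !modn_small // => -[->].
Qed.

End ValueCosets.

(** * The dynamics near the critical point *)

Section Dynamics.
Variables (L : fieldType) (w : valuation L) (l : nat).
Hypotheses (l_ge2 : (2 <= l)%N) (w_l : w l%:R = 0%E).
Variables (C : L) (C_ge0 : (0 <= w C)%E).
Local Notation f := (unicritical l C).

Let l_gt0 : (0 < l)%N. Proof. exact: leq_trans l_ge2. Qed.

Lemma unicriticalB x y : f x - f y = x ^+ l - y ^+ l.
Proof. by rewrite /unicritical opprB addrA subrK. Qed.

Lemma unicritical_ge0 x : (0 <= w x)%E -> (0 <= w (f x))%E.
Proof. by move=> x0; apply: val_sub_ge => //; exact: val_expr_ge0. Qed.

Lemma iter_ge0 n x : (0 <= w x)%E -> (0 <= w (iter n f x))%E.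
Proof. by move=> x0; elim: n => //= n; exact: unicritical_ge0. Qed.

Lemma unicritical_ge0_inv x : (0 <= w (f x))%E -> (0 <= w x)%E.
Proof.
move=> fx; apply: (val_root_ge0 l_gt0).
by rewrite -[x ^+ l](subrK C); exact: val_add_ge.
Qed.

Lemma iter_ge0_inv n x : (0 <= w (iter n f x))%E -> (0 <= w x)%E.
Proof. by elim: n => //= n IH /unicritical_ge0_inv. Qed.

(** The sum is (x^l - y^l) / (x - y) and reduces to l x^(l-1). *)
Lemma geometric_unit x y : w x = 0%E -> (0 < w (x - y)%R)%E ->
  w (\sum_(i < l) x ^+ (l.-1 - i) * y ^+ i) = 0%E.
Proof.
move=> wx xy; have [x' x'E] : exists t : val_ring w, val t = x.
  by apply: val_ring_lift; rewrite wx.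
have [y' y'E] : exists t : val_ring w, val t = y.
  apply: val_ring_lift; rewrite -[y](subKr x) val_sub_ge ?wx //; exact: ltW.
subst x y.
have rxy : res x' = res y' by apply/res_eqP.
have -> : \sum_(i < l) (val x') ^+ (l.-1 - i) * (val y') ^+ i =
          val (\sum_(i < l) x' ^+ (l.-1 - i) * y' ^+ i).
  by rewrite rmorph_sum; apply: eq_bigr => i _; rewrite rmorphM !rmorphXn.
apply/res_unitP.
have -> : res (\sum_(i < l) x' ^+ (l.-1 - i) * y' ^+ i) = res (l%:R * x' ^+ l.-1).
  rewrite rmorph_sum (eq_bigr (fun=> res x' ^+ l.-1)); last first.
    move=> i _; rewrite rmorphM !rmorphXn /= -rxy -exprD subnK //.
    by rewrite -ltnS prednK.
  by rewrite sumr_const card_ord rmorphM rmorph_nat mulr_natl rmorphXn.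
by apply/res_unitP; rewrite rmorphM rmorph_nat rmorphXn valM w_l val_expr0 ?adde0.
Qed.

Lemma unicritical_isometry x y : w x = 0%E -> (0 < w (x - y)%R)%E ->
  w (f x - f y) = w (x - y).
Proof.
by move=> wx xy; rewrite unicriticalB subrXX valM geometric_unit // adde0.
Qed.

Lemma unicritical_congr x y : (0 <= w x)%E -> (0 < w (x - y)%R)%E ->
  (0 < w (f x - f y)%R)%E.
Proof.
move=> x0 xy; rewrite unicriticalB subrXX val_mul_gt //; apply: val_sum_ge => i _.
have y0 : (0 <= w y)%E by rewrite -[y](subKr x) val_sub_ge // ltW.
by apply: val_mul_ge0; exact: val_expr_ge0.
Qed.

Lemma iter_congr n x y : (0 <= w x)%E -> (0 < w (x - y)%R)%E ->
  (0 < w (iter n f x - iter n f y)%R)%E.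
Proof.
by move=> x0 xy; elim: n => //= n; apply: unicritical_congr; exact: iter_ge0.
Qed.

Lemma iter_isometry n x y : (0 < w (x - y)%R)%E ->
  (forall i, (i < n)%N -> w (iter i f x) = 0%E) ->
  w (iter n f x - iter n f y) = w (x - y).
Proof.
move=> xy; elim: n => //= n IH unit_x.
have IHn := IH (fun i lin => unit_x i (ltnW lin)).
by rewrite unicritical_isometry ?IHn ?unit_x.
Qed.

Variable n : nat.
(** The number n is the exact period of 0 for the reduced map, in terms of
valuations. *)
Definition exact_period : Prop :=
  [/\ (0 < n)%N, (0 < w (iter n f 0)%R)%E &
      forall i, (0 < i < n)%N -> w (iter i f 0) = 0%E].
Hypothesis period : exact_period.
Local Notation e := (iter n f 0).

(** The first step gives f(z) - f(0) = z^l; the n - 1 remaining ones start at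
units, where f is an isometry. *)
Lemma return_map_val z : (0 < w z)%E -> w (iter n f z - e) = w (z ^+ l).
Proof.
move=> wz; case: period; case: n => // k _ _ unit0.
have zl : f 0 - f z = - z ^+ l.
  by rewrite unicriticalB expr0n eqn0Ngt l_gt0 sub0r.
rewrite !iterSr valB iter_isometry ?zl ?valN ?val_expr_gt0 // => i ik.
by rewrite -iterSr unit0.
Qed.

Lemma iter_period_gt0 j z : (0 < w z)%E -> (0 < w (iter (j * n) f z)%R)%E.
Proof.
case: period => n0 en _ wz; elim: j => // j IH.
rewrite mulSn iterD -[iter n f _](subrK e); apply: val_add_gt => //.
by rewrite return_map_val // val_expr_gt0.
Qed.

Lemma period_dvd j : (0 < w (iter j f 0)%R)%E -> (n %| j)%N.
Proof.
case: period => n0 en unit0 wj.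
have w0 : (0 < w 0%R)%E by rewrite val0 ltey.
rewrite /dvdn; have [//|r0] := posnP (j %% n)%N.
have := unit0 (j %% n)%N; rewrite r0 ltn_pmod // => /(_ isT) wr.
have : (0 < w (iter (j %% n)%N f 0)%R)%E; last by rewrite wr ltxx.
rewrite -[iter _ f 0](subKr (iter j f 0)); apply: val_sub_gt => //.
rewrite {1}(divn_eq j n) addnC iterD; apply: iter_congr.
  exact/ltW/iter_period_gt0.
by rewrite subr0; exact: iter_period_gt0.
Qed.

(** If e is not 0, then by induction all iterates f^(jn)(0) with j > 0 have the
valuation of e: the next one differs from e by something of valuation
l v(e) > v(e). None of them is 0. *)
Lemma period_exact N : (0 < N)%N -> iter N f 0 = 0 -> e = 0.
Proof.
move=> N0 fN; apply/eqP; apply: contraT => e0; case: (period) => n0 en _.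
have /dvdnP[j Nj] : (n %| N)%N by apply: period_dvd; rewrite fN val0 ltey.
have [r wr] := val_fin w e0.
have we i : w (iter (i.+1 * n) f 0) = w e.
  elim: i => [|i IH]; first by rewrite mul1n.
  rewrite mulSn iterD -[iter n f _](subrK e) addrC val_add_lt //.
  rewrite return_map_val ?IH // (@val_expr _ _ _ r) ?IH // wr lte_fin.
  have r0 : 0 < r by rewrite -lte_fin -wr.
  by rewrite -{1}(mulr1n r) ltr_pMn2l.
case: j Nj => [|j Nj]; first by rewrite mul0n => N00; rewrite N00 in N0.
by have := we j; rewrite -Nj fN val0 wr.
Qed.

(** Iterating further, both orbits land on 0 after a multiple of n steps; but the
return map multiplies the valuation of a nonzero point close to 0 by l, and so
never sends it to 0. *)
Lemma small_preimage_eq0 i m y :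
  e = 0 -> (0 < w y)%E -> iter i f y = iter m f 0 -> y = 0.
Proof.
move=> e0 wy fy; case: (period) => n0 _ _.
have per j : iter (j * n) f 0 = 0.
  by elim: j => // j IH; rewrite mulSn iterD IH.
(* M more steps after the m steps from 0 to iter m f 0 make m full periods. *)
pose M := (m * n.-1)%N.
have fMi : iter (M + i) f y = 0.
  by rewrite iterD fy -iterD /M -mulnSr prednK.
have /dvdnP[s sE] : (n %| M + i)%N.
  apply: period_dvd; have y00 : (0 < w (y - 0)%R)%E by rewrite subr0.
  by have := iter_congr (M + i) (ltW wy) y00; rewrite fMi sub0r valN.
apply/eqP; apply: contraT => y0.
have neq0 j : iter (j * n) f y != 0.
  elim: j => // j IH; rewrite mulSn iterD.
  have := return_map_val (iter_period_gt0 j wy); rewrite e0 subr0.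
  rewrite -[in X in _ -> X](val_eqy w) => ->.
  by rewrite val_eqy expf_eq0 negb_and IH orbT.
by have := neq0 s; rewrite -sE fMi eqxx.
Qed.

End Dynamics.

(** * Descent along preimages close to the critical point *)

Section Descent.
Variables (L : closedFieldType) (w : valuation L) (l : nat).
Hypotheses (l_ge2 : (2 <= l)%N) (w_l : w l%:R = 0%E).
Variables (C : L) (C_ge0 : (0 <= w C)%E).
Local Notation f := (unicritical l C).

Let l_gt0 : (0 < l)%N. Proof. exact: leq_trans l_ge2. Qed.

Lemma preimage_near k z x : (0 <= w z)%E -> (0 < w (iter k f z - x)%R)%E ->
  exists2 y, iter k f y = x & (0 < w (z - y)%R)%E.
Proof.
move=> z0; elim: k x => [|k IH] x; first by exists x.
move=> kx; pose P := 'X^l - (x + C)%:P.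
have mP : P \is monic by exact: monicXnsubC.
have [|r Pr zr] := @root_near _ w P (iter k f z) mP.
  suff -> : P.[iter k f z] = iter k.+1 f z - x by [].
  by rewrite /P !hornerE /= /unicritical opprD addrA addrAC.
have [y yr zy] := IH r zr; exists y => //=.
move: Pr; rewrite yr rootE !hornerE subr_eq0 => /eqP rl.
by rewrite /unicritical rl addrK.
Qed.

(** A root of 1 + X + ... + X^(l-1) will do: were it congruent to 1, this sum
would be congruent to l, a unit. *)
Lemma root_of_unity_far : exists zeta : L, zeta ^+ l = 1 /\ w (zeta - 1) = 0%E.
Proof.
pose S : {poly L} := \poly_(i < l) 1.
have sS : size S = l by rewrite size_poly_eq // oner_neq0.
have [zeta /rootP Sz] : exists z, root S z.
  by apply/closed_rootP; rewrite sS; case: (l) l_ge2 => [|[]].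
have sum0 : \sum_(i < l) zeta ^+ i = 0.
  by rewrite -[RHS]Sz horner_poly; apply: eq_bigr => i _; rewrite mul1r.
have zl : zeta ^+ l = 1.
  by apply/eqP; rewrite -subr_eq0 subrX1 sum0 mulr0.
have wz : w zeta = 0%E by apply: (val_root l_gt0); rewrite zl val1.
exists zeta; split => //; apply/eqP.
rewrite eq_le val_sub_ge ?wz ?val1 // andbT leNgt.
apply/negP => near1; have := geometric_unit l_ge2 w_l (val1 w).
move=> /(_ zeta); rewrite valB => /(_ near1).
under eq_bigr do rewrite expr1n mul1r.
by rewrite sum0 val0.
Qed.

Variable n : nat.
Hypothesis period : exact_period w l C n.
Local Notation e := (iter n f 0).

Lemma return_preimage y : (0 < w y)%E ->
  exists2 z, iter n f z = y & (0 < w z)%E.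
Proof.
move=> wy; have [_ we _] := period.
have [||z zy wz] := @preimage_near n 0 y.
- by rewrite val0 leey.
- exact: val_sub_gt.
by exists z => //; rewrite -valN -sub0r.
Qed.

Lemma val_return_preimage z y r : (0 < w z)%E -> iter n f z = y ->
  w (y - e) = r%:E -> w z = (r / l%:R)%:E.
Proof.
move=> wz zy; rewrite -zy (return_map_val l_ge2 w_l period wz) => wzl.
have z0 : z != 0.
  by apply/eqP => z0; move: wzl; rewrite z0 expr0n eqn0Ngt l_gt0 val0.
have [s ws] := val_fin w z0; move: wzl; rewrite (val_expr l ws) ws => -[<-].
by rewrite -[s *+ l]mulr_natr mulfK // pnatr_eq0 -lt0n.
Qed.

(** Start from a preimage y0 of alpha close to 0. If e = 0, then y0 works as it
is not 0. Otherwise take y1 close to 0 with f^n(y1) = y0. If v(y1) < v(e), then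
y1 works; otherwise one more preimage y2 has valuation v(y1 - e) / l, which is
v(e) / l provided that y1 is not too close to e. The exception occurs only for
v(y1) = v(e), and then multiplying y1 by a root of unity that is not congruent
to 1 moves it away from e without changing f(y1). *)
Lemma preimage_below m alpha : (0 < w (iter m f 0 - alpha)%R)%E ->
  (e = 0 -> iter m f 0 <> alpha) ->
  exists N y r, [/\ iter N f y = alpha, w y = r%:E, 0 < r & (w y < w e)%E].
Proof.
move=> m_alpha not_cycle; have [n0 we _] := period.
have [|y0 fy0] := preimage_near _ m_alpha; first by rewrite val0 leey.
rewrite sub0r valN => wy0.
have [e0|e_neq0] := eqVneq e 0.
  have y0_neq0 : y0 != 0 by apply/eqP => y00; apply: (not_cycle e0); rewrite -y00.
  have [r wr] := val_fin w y0_neq0; exists m, y0, r; split => //.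
    by rewrite -lte_fin -wr.
  by rewrite e0 val0 wr ltey.
have [eps weps] := val_fin w e_neq0.
have eps_gt0 : 0 < eps by rewrite -lte_fin -weps.
have [y1 [fy1 wy1 y1P]] : exists y1, [/\ iter n f y1 = y0, (0 < w y1)%E &
    (w y1 < w e)%E \/ w (y1 - e) = w e].
  have [y1 fy1 wy1] := return_preimage wy0.
  case: (ltgtP (w y1) (w e)) => [lt|gt|eq].
  - by exists y1; split => //; left.
  - exists y1; split => //; right.
    by rewrite addrC val_add_lt valN.
  have [near|far] := ltP (w e) (w (y1 - e)).
    (* The exceptional case: y1 is replaced by zeta * y1. *)
    have [zeta [zl wzeta]] := root_of_unity_far.
    exists (zeta * y1); split.
    - rewrite -fy1; case: (n) n0 => // k _; rewrite !iterSr; congr (iter k f _).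
      by rewrite /unicritical exprMn zl mul1r.
    - by rewrite valM (val_root l_gt0) ?add0e // zl val1.
    right; have -> : zeta * y1 - e = (zeta - 1) * y1 + (y1 - e) by ring.
    by rewrite val_add_lt valM wzeta add0e eq.
  exists y1; split => //; right; apply/eqP; rewrite eq_le far.
  by apply: val_sub_ge; rewrite ?eq.
have small : (w y1 < w e)%E \/ exists2 y2, iter n f y2 = y1 & w y2 = (eps / l%:R)%:E.
  case: y1P => [|w1e]; first by left.
  have [y2 fy2 wy2] := return_preimage wy1.
  by right; exists y2 => //; apply: (val_return_preimage wy2 fy2); rewrite w1e.
case: small => [lt|[y2 fy2 wy2]].
  have y1_neq0 : y1 != 0.
    by apply: contraTneq lt => ->; rewrite val0 -leNgt leey.
  have [r wr] := val_fin w y1_neq0.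
  exists (m + n)%N, y1, r; split => //; first by rewrite iterD fy1.
  by rewrite -lte_fin -wr.
exists (m + n + n)%N, y2, (eps / l%:R); split => //.
- by rewrite 2!iterD fy2 fy1.
- by rewrite divr_gt0 ?ltr0n.
- by rewrite wy2 weps lte_fin ltr_pdivrMr ?ltr0n // ltr_pMr // ltr1n.
Qed.

(** As v(y) < v(e), subtracting e does not change the valuation of y, and by the
return map estimate a preimage close to 0 has the l-th part of it. *)
Lemma preimage_descent alpha N y r :
  iter N f y = alpha -> w y = r%:E -> 0 < r -> (w y < w e)%E ->
  forall k, exists N' y', iter N' f y' = alpha /\ w y' = (r / (l ^ k)%:R)%:E.
Proof.
move=> fy wy r0 ye; elim=> [|k [N' [y' [fy' wy']]]].
  by exists N, y; rewrite expn0 divr1.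
have lk0 : 0 < (l ^ k)%:R :> rat by rewrite ltr0n expn_gt0 l_gt0.
have [|z fz wz] := @return_preimage y'; first by rewrite wy' lte_fin divr_gt0.
exists (N' + n)%N, z; split; first by rewrite iterD fz.
rewrite expnSr natrM invfM mulrA; apply: (val_return_preimage wz fz).
rewrite val_add_lt ?valN // wy'; apply: le_lt_trans ye; rewrite wy lee_fin.
rewrite ler_pdivrMr //; apply: ler_peMr; first exact: ltW.
by rewrite ler1n expn_gt0 l_gt0.
Qed.

End Descent.

(** * The field generated by the backward orbit *)

Lemma closed_field_rootn (L : closedFieldType) l (u : L) : (0 < l)%N ->
  exists z, z ^+ l = u.
Proof.
move=> l0; have [|z] := @closed_rootP L ('X^l - u%:P) _.
  by rewrite size_XnsubC // eqSS -lt0n.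
by rewrite rootE !hornerE subr_eq0 => /eqP zl; exists z.
Qed.

Section BackwardOrbitField.
Variables (K : fieldType) (L : closedFieldType) (iota : {rmorphism K -> L}).
Variables (l : nat) (l_gt0 : (0 < l)%N) (c a : K).
Local Notation f := (unicritical l (iota c)).

Lemma subfield_adjoin_closed (G : set L) :
  divring_closed (mem (subfield_adjoin iota G)).
Proof.
split=> [|x y|x y]; rewrite !inE.
- by move=> E [clE _]; exact: subfield1 clE.
- by move=> Ex Ey E EP; apply: (subfieldB EP.1); [exact: Ex|exact: Ey].
- by move=> Ex Ey E EP; apply: (subfield_div EP.1); [exact: Ex|exact: Ey].
Qed.

Lemma subfield_adjoin_base (G : set L) x : subfield_adjoin iota G (iota x).
Proof. by move=> E [_ sE]; apply: sE; left; exists x. Qed.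

Lemma subfield_adjoin_gen (G : set L) x : G x -> subfield_adjoin iota G x.
Proof. by move=> Gx E [_ sE]; apply: sE; right. Qed.

Lemma subfield_adjoin_sub (G E : set L) : divring_closed (mem E) ->
  (forall x, E (iota x)) -> G `<=` E -> subfield_adjoin iota G `<=` E.
Proof.
move=> clE bE GE x; apply; split => //.
by move=> y [[z _ <-]|Gy]; [exact: bE|exact: GE].
Qed.

(** A point of level n is the image under f of one of level n + 1. *)
Lemma K_S n : K_ iota l c a n `<=` K_ iota l c a n.+1.
Proof.
apply: subfield_adjoin_sub => [|x|y fy].
- exact: subfield_adjoin_closed.
- exact: subfield_adjoin_base.
have [z zl] := closed_field_rootn (y + iota c) l_gt0.
have fz : f z = y by rewrite /unicritical zl addrK.
have Ez : K_ iota l c a n.+1 z.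
  by apply: subfield_adjoin_gen; rewrite /backward_orbit /= -iterS iterSr fz.
rewrite -fz; apply: (subfieldB (subfield_adjoin_closed _)).
  exact: (subfieldX (subfield_adjoin_closed _)).
exact: subfield_adjoin_base.
Qed.

Lemma K_leq m n : (m <= n)%N -> K_ iota l c a m `<=` K_ iota l c a n.
Proof.
move=> /subnK <-; elim: (n - m)%N => // k IH x Kx.
rewrite addSn; apply: K_S; exact: IH.
Qed.

Lemma K_infty_closed : divring_closed (mem (K_infty iota l c a)).
Proof.
have two x y : K_infty iota l c a x -> K_infty iota l c a y ->
    exists2 n, (1 <= n)%N & K_ iota l c a n x /\ K_ iota l c a n y.
  move=> [m m1 Kx] [n n1 Ky]; exists (maxn m n); first by rewrite leq_max m1.
  by split; [apply: K_leq Kx; rewrite leq_maxl|apply: K_leq Ky; rewrite leq_maxr].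
split=> [|x y|x y]; rewrite !inE.
- by exists 1%N => //; exact: subfield1 (subfield_adjoin_closed _).
- move=> Kx Ky; have [n n1 [nx ny]] := two x y Kx Ky.
  exists n => //.
  exact: (@subfieldB _ (K_ iota l c a n) (subfield_adjoin_closed _) _ _ nx ny).
- move=> Kx Ky; have [n n1 [nx ny]] := two x y Kx Ky.
  exists n => //.
  exact: (@subfield_div _ (K_ iota l c a n) (subfield_adjoin_closed _) _ _ nx ny).
Qed.

Lemma K_infty_base x : K_infty iota l c a (iota x).
Proof. by exists 1%N => //; exact: subfield_adjoin_base. Qed.

Lemma K_infty_gen n y : iter n f y = iota a -> K_infty iota l c a y.
Proof.
by move=> fy; exists n.+1 => //; apply: K_S; exact: subfield_adjoin_gen.
Qed.

Lemma K_infty_sub (E : set L) : divring_closed (mem E) ->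
  (forall x, E (iota x)) -> (forall n y, iter n f y = iota a -> E y) ->
  K_infty iota l c a `<=` E.
Proof.
by move=> clE bE gE x [n _]; apply: subfield_adjoin_sub => // y; exact: gE.
Qed.

End BackwardOrbitField.

(** * Ramification of towers of roots *)

Section Tower.
Variables (K : fieldType) (v : valuation K) (L : closedFieldType) (w : valuation L).
Variables (iota : {rmorphism K -> L}) (ext : extends_valuation v w iota).
Hypothesis complete : complete_valuation v.
Variables (l : nat) (l_gt0 : (0 < l)%N) (w_l : w l%:R = 0%E).

(** Each step back along the orbit extracts an l-th root of a unit, or of 0. *)
Lemma unramified_tower c j y :
  max_unramified ext (iter j (unicritical l (iota c)) y) ->
  (forall i, (i < j)%N -> let z := iter i (unicritical l (iota c)) y in
                          z = 0 \/ w z = 0%E) ->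
  max_unramified ext y.
Proof.
have clU := max_unramified_subfield ext complete.
elim: j => // j IH Uj unit; apply: IH => [|i ij]; last exact/unit/ltnW.
have /= [->|wj] := unit j (ltnSn j); first exact: subfield0 clU.
apply: (max_unramified_rootn complete w_l l_gt0); last exact: val_expr0.
rewrite -[_ ^+ l](subrK (iota c)); apply: subfieldD => //.
exact: max_unramified_base.
Qed.

(** The trivial ramification index is the case l = 1 of the counting lemma. *)
Lemma unramified_sub g (E : set L) : 0 < g ->
  value_group v setT = range (fun m : int => g *~ m) ->
  divring_closed (mem E) -> (forall x, E (iota x)) ->
  E `<=` max_unramified ext -> unramified v w iota E.
Proof.
move=> g0 vg clE bE EU; split.
  have [|e re] := @ramification_index_dvd _ v _ w iota ext g g0 vg 1 isT E clE bE.
    move=> x /EU Ux x0; have [b b0 <-] := max_unramified_value Ux x0.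
    by have [m ->] := value_multiple vg b0; exists m; rewrite divr1.
  by rewrite dvdn1 => /eqP <-.
by move=> x /EU Ux wx; exact: max_unramified_residue Ux wx.
Qed.

End Tower.

Section Reduction.
Variables (K : fieldType) (v : valuation K) (l : nat) (c : K).
Hypothesis c_ge0 : (0 <= v c)%E.

Lemma reduction0 : reduction v 0 = 0.
Proof. by apply/eqP; rewrite reduction_eq0 val0 ?ltey ?leey. Qed.

Lemma reduction_iter n x : (0 <= v x)%E ->
  iter n (unicritical l (reduction v c)) (reduction v x) =
  reduction v (iter n (unicritical l c) x).
Proof.
move=> x0; elim: n => //= n ->.
have n0 := iter_ge0 l c_ge0 n x0.
by rewrite {1}/unicritical -reductionX // -reductionB ?val_expr_ge0.
Qed.

End Reduction.

Lemma unicritical_morph (K L : fieldType) (iota : {rmorphism K -> L}) l c n x :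
  iota (iter n (unicritical l c) x) = iter n (unicritical l (iota c)) (iota x).
Proof. by elim: n => //= n <-; rewrite /unicritical rmorphB rmorphXn. Qed.

(** From some k on the values lie strictly between 0 and g, where distinct values
are in distinct cosets of the multiples of g. *)
Lemma infinite_value_cosets (K : fieldType) (v : valuation K) (L : fieldType)
    (w : valuation L) (E : set L) (g r : rat) (l : nat) :
  0 < g -> value_group v setT = range (fun m : int => g *~ m) ->
  0 < r -> (2 <= l)%N ->
  (forall k, exists2 y, E y & w y = (r / (l ^ k)%:R)%:E) ->
  infinite_set (value_cosets v w E).
Proof.
move=> g0 vg r0 l2 small.
have l1 : (1 < l)%N by [].
have lk0 k : 0 < (l ^ k)%:R :> rat by rewrite ltr0n expn_gt0 (ltnW l1).
pose q k : rat := r / (l ^ k)%:R.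
have q0 k : 0 < q k by exact: divr_gt0.
(* From k0 on the values are smaller than g, since l^k > k. *)
pose k0 := Num.bound `|r / g|.
have qg k : q (k0 + k)%N < g.
  rewrite /q ltr_pdivrMr // mulrC -ltr_pdivrMr //.
  apply: le_lt_trans (ler_norm _) _.
  apply: lt_le_trans (archi_boundP (normr_ge0 _)) _.
  rewrite ler_nat; apply: leq_trans (leq_addr k _) _; exact/ltnW/ltn_expl.
pose phi k := coset v (q (k0 + k)%N).
have phi_inj : {in [set: nat] &, injective phi}.
  move=> i j _ _ /(coset_eqP vg)[m qm].
  have m0 : m = 0.
    have : `|g *~ m| < g.
      rewrite -qm ltr_norml; apply/andP; split.
        by rewrite ltrBrDr; apply: lt_trans (q0 _); rewrite addrC subr_lt0.
      by rewrite ltrBlDr; apply: lt_trans (qg i) _; rewrite ltrDl.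
    rewrite -mulrzr normrM gtr0_norm // -[ltRHS]mulr1 ltr_pM2l // -intr_norm ltrz1.
    by move=> h; apply/eqP; rewrite -absz_eq0 -leqn0 -ltnS -ltz_nat abszE.
  move/eqP: qm; rewrite m0 mulr0z subr_eq0 => /eqP.
  rewrite /q => /(mulfI (lt0r_neq0 r0)) /invr_inj /eqP.
  by rewrite eqr_nat eqn_exp2l // eqn_add2l => /eqP.
have sub : [set phi k | k in [set: nat]] `<=` value_cosets v w E.
  move=> _ [k _ <-]; have [y Ey wy] := small (k0 + k)%N.
  exists (q (k0 + k)%N) => //; exists y; last by rewrite wy.
  by split => //; rewrite -(val_eqy w) wy.
move=> /(sub_finite_set sub); rewrite (eq_finite_set (inj_card_eq phi_inj)).
exact: infinite_nat.
Qed.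

Lemma natr_residue_unit (K : fieldType) (v : valuation K) p l :
  has_characteristic (residue v) p -> ~~ (p %| l)%N -> (0 < l)%N -> v l%:R = 0%E.
Proof.
move=> charp pl l0; apply/eqP; rewrite -res_natr_neq0.
case: charp => [pP|[_ /pcharf0P ->]]; last by rewrite -lt0n.
by rewrite -(dvdn_pcharf pP).
Qed.

(** * The four cases *)

Section Main.
Variables (K : fieldType) (v : valuation K) (L : closedFieldType) (w : valuation L).
Variables (iota : {rmorphism K -> L}) (ext : extends_valuation v w iota).
Hypothesis complete : complete_valuation v.
Variables (l : nat) (l_ge2 : (2 <= l)%N) (v_l : v l%:R = 0%E).
Variables (c a : K) (c_ge0 : (0 <= v c)%E) (a_ge0 : (0 <= v a)%E).
Variables (g : rat) (g_gt0 : 0 < g).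
Hypothesis vg : value_group v setT = range (fun m : int => g *~ m).

Local Notation fK := (unicritical l c).
Local Notation f := (unicritical l (iota c)).
Local Notation fr := (unicritical l (reduction v c)).

Let l_gt0 : (0 < l)%N. Proof. exact: leq_trans l_ge2. Qed.
Let w_l : w l%:R = 0%E. Proof. by rewrite -(rmorph_nat iota) ext. Qed.
Let wc_ge0 : (0 <= w (iota c))%E. Proof. by rewrite ext. Qed.
Let wa_ge0 : (0 <= w (iota a))%E. Proof. by rewrite ext. Qed.

Lemma orbit_reductionP n x : (0 <= v x)%E ->
  iter n fr 0 = reduction v x <-> (0 < w (iter n f 0 - iota x)%R)%E.
Proof.
move=> x0; have v0 : (0 <= v 0%R)%E by rewrite val0 leey.
have := reduction_iter l c_ge0 n v0; rewrite (reduction0 v) => ->.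
rewrite reduction_eqP ?iter_ge0 //.
by rewrite -ext rmorphB unicritical_morph rmorph0.
Qed.

Lemma orbit_reduction0 n : iter n fr 0 = 0 <-> (0 < w (iter n f 0)%R)%E.
Proof.
have v0 : (0 <= v 0%R)%E by rewrite val0 leey.
by have := orbit_reductionP n v0; rewrite reduction0 rmorph0 subr0.
Qed.

Lemma preimage_ge0 n y : iter n f y = iota a -> (0 <= w y)%E.
Proof. by move=> fy; apply: (iter_ge0_inv l_ge2 wc_ge0 (n := n)); rewrite fy. Qed.

(** If f^i(y) reduces to 0, then applying the remaining n - i steps shows that a
is congruent to f^(n-i)(0). *)
Lemma iter_val_dichotomy n y i : iter n f y = iota a -> (i <= n)%N ->
  (w (iter i f y) = 0)%E \/
  (0 < w (iter i f y)%R)%E /\ (0 < w (iter (n - i) f 0 - iota a)%R)%E.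
Proof.
move=> fy le_in; have y0 := iter_ge0 l wc_ge0 i (preimage_ge0 fy).
have [pos|] := ltP 0%E (w (iter i f y)); last first.
  by move=> neg; left; apply/eqP; rewrite eq_le neg.
right; split => //; rewrite -fy -{2}(subnK le_in) iterD.
have := @iter_congr _ w l _ wc_ge0 (n - i) 0 (iter i f y).
by rewrite sub0r valN val0 => /(_ (leey _) pos).
Qed.

Lemma K_infty_unramified :
  (forall n y, iter n f y = iota a -> forall i, (i < n)%N ->
     iter i f y = 0 \/ w (iter i f y) = 0%E) ->
  unramified v w iota (K_infty iota l c a).
Proof.
move=> unit; apply: (unramified_sub (ext := ext) g_gt0 vg).
- exact: (K_infty_closed _ l_gt0).
- exact: K_infty_base.
apply: K_infty_sub => [|x|n y fy].
- exact: max_unramified_subfield.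
- exact: max_unramified_base.
apply: (unramified_tower complete l_gt0 w_l (c := c) (j := n)); last exact: unit.
by rewrite fy; exact: max_unramified_base.
Qed.

Lemma unramified_off_orbit : ~ forward_orbit fr 0 (reduction v a) ->
  unramified v w iota (K_infty iota l c a).
Proof.
move=> not_orbit; apply: K_infty_unramified => n y fy i ltin; right.
have [//|[_ h]] := iter_val_dichotomy fy (ltnW ltin).
by case: not_orbit; exists (n - i)%N => //; apply/orbit_reductionP.
Qed.

Lemma exact_period_exists N : (0 < N)%N -> iter N fr 0 = 0 ->
  exists n, exact_period w l (iota c) n.
Proof.
move=> N0 /orbit_reduction0 fN.
have exn : exists n : nat, (0 < n)%N && (0 < w (iter n f 0)%R)%E.
  by exists N; rewrite N0.
case: (ex_minnP exn) => n /andP[n0 wn] minn; exists n; split => // i /andP[i0 lt_in].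
have i_ge0 : (0 <= w (iter i f 0)%R)%E by apply: iter_ge0 => //; rewrite val0 leey.
apply/eqP; rewrite eq_le i_ge0 andbT leNgt; apply/negP => wi.
by have := minn i; rewrite i0 wi leqNgt lt_in => /(_ isT).
Qed.

Lemma unramified_exact_cycle :
  in_single_cycle fK 0 a -> unramified v w iota (K_infty iota l c a).
Proof.
move=> [[N N0 fN] [m fm]]; have fN' : iter N f 0 = 0.
  by rewrite -[in LHS](rmorph0 iota) -unicritical_morph fN rmorph0.
have fm' : iter m f 0 = iota a.
  by rewrite -[in LHS](rmorph0 iota) -unicritical_morph fm.
have [|n per] := @exact_period_exists N N0.
  by apply/orbit_reduction0; rewrite fN' val0 ltey.
have e0 := period_exact l_ge2 w_l wc_ge0 per N0 fN'.
apply: K_infty_unramified => n' y fy i ltin.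
have [|[pos _]] := iter_val_dichotomy fy (ltnW ltin); first by right.
left; apply: (small_preimage_eq0 l_ge2 w_l wc_ge0 per
                (i := (n' - i)%N) (m := m) e0 pos).
by rewrite -iterD subnK ?fm' // ltnW.
Qed.

Lemma infinitely_ramified_residual_cycle :
  in_single_cycle fr 0 (reduction v a) -> ~ in_single_cycle fK 0 a ->
  infinitely_ramified v w (K_infty iota l c a).
Proof.
move=> [[N N0 fN] [m fm]] not_cycle.
have [n per] := exact_period_exists N0 fN.
have [||N1 [y [r [fy wy r0 ye]]]] :=
  preimage_below l_ge2 w_l per (m := m) (alpha := iota a).
- exact/orbit_reductionP.
- move=> e0 fm'; apply: not_cycle; case: per => n0 _ _; split.
    exists n => //; apply: (fmorph_inj iota).
    by rewrite unicritical_morph rmorph0.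
  by exists m; apply: (fmorph_inj iota); rewrite unicritical_morph rmorph0.
apply: (infinite_value_cosets g_gt0 vg r0 l_ge2) => k.
have [N2 [y' [fy' wy']]] := preimage_descent l_ge2 w_l per fy wy r0 ye k.
by exists y' => //; exact: K_infty_gen fy'.
Qed.

Lemma iter_near0_unit k z :
  (forall i, (0 < i)%N -> w (iter i f 0) = 0%E) ->
  (0 < k)%N -> (0 < w z)%E -> w (iter k f z) = 0%E.
Proof.
move=> orbit_unit k0 wz.
have := @iter_congr _ w l _ wc_ge0 k 0 z.
rewrite sub0r valN val0 => /(_ (leey _) wz) => near.
rewrite -[iter k f z](subKr (iter k f 0)) val_add_lt ?orbit_unit //.
by rewrite valN.
Qed.

Lemma uniformizer_exists : exists pi, v pi = g%:E.
Proof.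
have : value_group v setT g by rewrite vg; exists 1.
by move=> [x [_ x0] <-]; exists x; have [r ->] := val_fin v x0.
Qed.

Section Radical.
Variables (pi : K) (varpi : L).
Hypotheses (v_pi : v pi = g%:E) (varpi_l : varpi ^+ l = iota pi).

Local Notation v1 := (radical_val w iota l pi varpi).
Local Notation iota1 := (radical_emb iota l pi varpi).

Let ext1 : extends_valuation v1 w iota1. Proof. exact: radical_ext_val. Qed.

Let complete1 : complete_valuation v1.
Proof.
exact: (@radical_complete _ _ _ _ _ ext complete _ g_gt0 vg _ l_gt0 _ _
          v_pi varpi_l).
Qed.

Local Notation U := (max_unramified ext).
Local Notation U1 := (max_unramified ext1).

Let clU : divring_closed (mem U). Proof. exact: max_unramified_subfield. Qed.
Let clU1 : divring_closed (mem U1). Proof. exact: max_unramified_subfield. Qed.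

Lemma radical_max_unramified_base x : U1 (iota x).
Proof.
have [u <-] : exists u, iota1 u = iota x by exact: radical_base.
exact: max_unramified_base.
Qed.

Lemma radical_tower j y : U1 (iter j f y) ->
  (forall i, (i < j)%N -> w (iter i f y) = 0%E) -> U1 y.
Proof.
have [c1 c1E] : exists u, iota1 u = iota c by exact: radical_base.
rewrite -c1E => h unit; apply: (unramified_tower complete1 l_gt0 w_l h).
by move=> i ij; right; exact: unit.
Qed.

(** The valuation of t^l is a multiple k g with k a natural number; then
(t / varpi^k)^l is a unit of the field generated over K(varpi), whose l-th root
is unramified there. That t^l is unramified over K itself is what makes its
valuation a multiple of g. *)
Lemma radical_rootn t : (0 < w t)%E -> U (t ^+ l) -> U1 (t ^+ l) -> U1 t.
Proof.
move=> wt Utl U1tl.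
have [->|t0] := eqVneq t 0; first exact: subfield0 clU1.
have [b b0 vb] := max_unramified_value Utl (expf_neq0 _ t0).
have [m vm] := value_multiple vg b0.
have m_ge0 : 0 <= m.
  have : (0 < v b)%E by rewrite vb val_expr_gt0.
  rewrite vm lte_fin => gm; rewrite -(ler0z rat) -(pmulr_rge0 _ g_gt0) mulrzr.
  exact: ltW.
have [k mk] : exists k : nat, m = k%:Z by exists `|m|%N; rewrite gez0_abs.
have U1p : U1 varpi.
  have [u uE] : exists u, iota1 u = varpi by exact: radical_varpi.
  by have := max_unramified_base ext1 u; rewrite uE.
have p0 : varpi != 0.
  by rewrite -(val_eqy w) (value_varpi ext l_gt0 v_pi varpi_l).
rewrite -[t](@divfK _ (varpi ^+ k)) ?expf_neq0 //.
apply: (subfieldM clU1); last by apply: (subfieldX clU1).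
have wtl : w (t ^+ l) = (g *+ k)%:E by rewrite -vb vm mk pmulrn.
have wpk : w ((varpi ^+ k) ^+ l) = (g *+ k)%:E.
  by rewrite exprAC varpi_l; apply: val_expr; rewrite ext.
apply: (max_unramified_rootn complete1 w_l l_gt0); rewrite expr_div_n.
  by apply: (subfield_div clU1) => //; do 2 apply: (subfieldX clU1).
by rewrite (val_div wtl wpk) subrr.
Qed.

(** At most one point f^s(y) with s < n reduces to 0. The points beyond it are
unramified over K, that point is handled by [radical_rootn], and the way from
it back to y only extracts roots of units. *)
Lemma backward_orbit_radical n y :
  (forall i, (0 < i)%N -> w (iter i f 0) = 0%E) -> iter n f y = iota a -> U1 y.
Proof.
move=> orbit_unit fy.
have [[s ltsn ws]|unit] :=
    pselect (exists2 s, (s < n)%N & (0 < w (iter s f y)%R)%E); last first.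
  apply: (radical_tower (j := n)).
    by rewrite fy; exact: radical_max_unramified_base.
  move=> i ltin; have [//|[pos _]] := iter_val_dichotomy fy (ltnW ltin).
  by case: unit; exists i.
set t := iter s f y in ws *.
have near0 s1 s2 : (s1 < s2)%N -> (0 < w (iter s1 f y)%R)%E ->
    w (iter s2 f y) = 0%E.
  move=> lt12 w1; rewrite -(subnK (ltnW lt12)) iterD.
  by apply: iter_near0_unit; rewrite ?subn_gt0.
have unit i : (i < n)%N -> i != s -> w (iter i f y) = 0%E.
  move=> ltin; rewrite neq_ltn => /orP[lt|lt]; last exact: near0 lt ws.
  have [//|[pos _]] := iter_val_dichotomy fy (ltnW ltin).
  by have := near0 _ _ lt pos; move: ws; rewrite /t => /[swap] ->; rewrite ltxx.
have fx : iter (n - s.+1) f (f t) = iota a.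
  by rewrite /t -iterS -iterD subnK.
have unit_x i : (i < n - s.+1)%N -> w (iter i f (f t)) = 0%E.
  rewrite /t -iterS -iterD ltn_subRL addnC => h; apply: unit => //.
  by rewrite gtn_eqF // addnS ltnS leq_addl.
have U1x : U1 (f t).
  apply: (radical_tower (j := (n - s.+1)%N)) => //.
  by rewrite fx; exact: radical_max_unramified_base.
have Ux : U (f t).
  apply: (unramified_tower complete l_gt0 w_l (j := (n - s.+1)%N) (c := c)).
    by rewrite fx; exact: max_unramified_base.
  by move=> i /unit_x; right.
apply: (radical_tower (j := s)); last first.
  move=> i lis; apply: unit; first exact: ltn_trans lis ltsn.
  by rewrite ltn_eqF.
have tl : t ^+ l = f t + iota c by rewrite /unicritical subrK.
apply: radical_rootn => //; rewrite tl.
  by apply: (subfieldD clU Ux); exact: max_unramified_base.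
by apply: (subfieldD clU1 U1x); exact: radical_max_unramified_base.
Qed.

Lemma K_infty_radical_value x :
  (forall i, (0 < i)%N -> w (iter i f 0) = 0%E) ->
  K_infty iota l c a x -> x != 0 ->
  exists m : int, w x = ((g / l%:R) *~ m)%:E.
Proof.
move=> orbit_unit Kx x0.
have /max_unramified_value/(_ x0)[u u0 <-] : U1 x.
  apply: K_infty_sub Kx => [|z|n y].
  - exact: clU1.
  - exact: radical_max_unramified_base.
  - exact: backward_orbit_radical.
exact: (radical_value ext g_gt0 vg l_gt0 v_pi varpi_l u0).
Qed.

End Radical.

Lemma ramification_strictly_preperiodic : strictly_preperiodic fr 0 ->
  exists2 e : nat, ramification_index v w (K_infty iota l c a) e & (e %| l)%N.
Proof.
move=> [_ not_per].
have orbit_unit i : (0 < i)%N -> w (iter i f 0) = 0%E.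
  move=> i0; have i_ge0 : (0 <= w (iter i f 0)%R)%E.
    by apply: iter_ge0 => //; rewrite val0 leey.
  apply/eqP; rewrite eq_le i_ge0 andbT leNgt; apply/negP => /orbit_reduction0 fi.
  by apply: not_per; exists i.
have [pi v_pi] := uniformizer_exists.
have [varpi varpi_l] := closed_field_rootn (iota pi) l_gt0.
apply: (ramification_index_dvd ext g_gt0 vg l_gt0).
- exact: (K_infty_closed _ l_gt0).
- exact: K_infty_base.
by move=> x; exact: (K_infty_radical_value v_pi varpi_l orbit_unit).
Qed.

End Main.

Theorem theorem7p4 (K : fieldType) (v : valuation K)
    (v_discrete : discrete_valuation v) (v_complete : complete_valuation v)
    (p : nat) (char_residue : has_characteristic (residue v) p)
    (Kbar : closedFieldType) (iota : {rmorphism K -> Kbar})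
    (Kbar_closure : is_algebraic_closure iota)
    (w : valuation Kbar) (w_extends : extends_valuation v w iota)
    (l : nat) (l_ge2 : (2 <= l)%N) (p_ndvd_l : ~~ (p %| l)%N)
    (c a : K) (c_neq0 : c != 0) (vc_ge0 : (0 <= v c)%E) (va_ge0 : (0 <= v a)%E) :
  [/\ (~ forward_orbit (unicritical l (reduction v c)) 0 (reduction v a) ->
        unramified v w iota (K_infty iota l c a)),
      (strictly_preperiodic (unicritical l (reduction v c)) 0 ->
        exists2 e : nat, ramification_index v w (K_infty iota l c a) e &
          (e %| l)%N),
      (in_single_cycle (unicritical l c) 0 a ->
        unramified v w iota (K_infty iota l c a)) &
      (in_single_cycle (unicritical l (reduction v c)) 0 (reduction v a) ->
        ~ in_single_cycle (unicritical l c) 0 a ->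
        infinitely_ramified v w (K_infty iota l c a))].
Proof.
have [g g0 vg] := v_discrete.
have v_l := natr_residue_unit char_residue p_ndvd_l (ltnW l_ge2).
split.
- exact: (unramified_off_orbit w_extends v_complete l_ge2 v_l
            vc_ge0 va_ge0 g0 vg).
- exact: (ramification_strictly_preperiodic w_extends v_complete l_ge2 v_l
            vc_ge0 va_ge0 g0 vg).
- exact: (unramified_exact_cycle w_extends v_complete l_ge2 v_l
            vc_ge0 va_ge0 g0 vg).
- exact: (infinitely_ramified_residual_cycle w_extends l_ge2 v_l
            vc_ge0 va_ge0 g0 vg).
Qed.
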